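(* Let $\mathcal{G}$ be a class of graphs that is contained in the class of $P_4$-extendible graphs or contained in the class of $P_4$-sparse graphs, and that is closed under taking complements and under taking induced subgraphs. Let $G$ be a graph in $\mathcal{G}$. Then $G$ is a minimal polar obstruction if and only if either $G$ or its complement is isomorphic to $\overline{P_3}\oplus E$, where $E$ is one of the seven graphs $K_1+2K_2$, $2P_3$, $2K_1+C_4$, $K_1+\overline{P_3+K_2}$, $K_1+C_5$, $K_1+P$, $K_1+\overline{P_5}$.
   Context: All graphs are simple and finite; graph classes are closed under isomorphism. $G+H$ is disjoint union, $nG$ is the disjoint union of $n$ copies of $G$, $G\oplus H$ is the join $\overline{\overline{G}+\overline{H}}$. $P$ (the banner) is the 5-vertex graph obtained from $C_4$ by attaching one pendant vertex to one vertex of the cycle. A cluster is a disjoint union of complete graphs. A graph $G$ is polar (i.e. $(\infty,\infty)$-polar) if its vertex set has a partition $(A,B)$ (parts may be empty) such that $G[A]$ is a complete multipartite graph (with any number of parts) and $G[B]$ is a cluster. A minimal polar obstruction is a graph that is not polar but all of whose proper induced subgraphs are polar. ''A $P_4$'' of a graph means an induced path on four vertices. A graph is $P_4$-sparse if every set of five vertices induces at most one $P_4$. A graph is $P_4$-extendible if for every vertex subset $W$ inducing a $P_4$, there is at most one vertex $v\notin W$ that belongs to a $P_4$ sharing vertices with $W$. *)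

(* Defs.v *)
From mathcomp Require Import all_boot.

Set Implicit Arguments.
Unset Strict Implicit.
Unset Printing Implicit Defensive.

Record sgraph := SGraph {
  vertex :> finType;
  adj : rel vertex;
  adj_sym : symmetric adj;
  adj_irrefl : irreflexive adj }.

Definition iso (G H : sgraph) : Prop :=
  exists2 f : G -> H, bijective f & forall x y, adj (f x) (f y) = adj x y.

Section Operations.
Variables G H : sgraph.

Definition induced_adj (S : {set G}) : rel {x : G | x \in S} :=
  fun x y => adj (val x) (val y).
Lemma induced_sym S : symmetric (@induced_adj S).
Proof. by move=> x y; rewrite /induced_adj adj_sym. Qed.
Lemma induced_irrefl S : irreflexive (@induced_adj S).
Proof. by move=> x; rewrite /induced_adj adj_irrefl. Qed.
Definition induced (S : {set G}) : sgraph :=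
  SGraph (@induced_sym S) (@induced_irrefl S).

Definition compl_adj : rel G := fun x y => (x != y) && ~~ adj x y.
Lemma compl_sym : symmetric compl_adj.
Proof. by move=> x y; rewrite /compl_adj eq_sym adj_sym. Qed.
Lemma compl_irrefl : irreflexive compl_adj.
Proof. by move=> x; rewrite /compl_adj eqxx. Qed.
Definition compl : sgraph := SGraph compl_sym compl_irrefl.

Definition dunion_adj : rel (G + H)%type := fun x y =>
  match x, y with
  | inl u, inl v => adj u v
  | inr u, inr v => adj u v
  | _, _ => false
  end.
Lemma dunion_sym : symmetric dunion_adj.
Proof. by case=> x [] y //=; rewrite adj_sym. Qed.
Lemma dunion_irrefl : irreflexive dunion_adj.
Proof. by case=> x /=; rewrite adj_irrefl. Qed.
Definition dunion : sgraph := SGraph dunion_sym dunion_irrefl.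

Definition copies_adj (n : nat) : rel ('I_n * G)%type :=
  fun x y => (x.1 == y.1) && adj x.2 y.2.
Lemma copies_sym n : symmetric (@copies_adj n).
Proof. by move=> x y; rewrite /copies_adj eq_sym adj_sym. Qed.
Lemma copies_irrefl n : irreflexive (@copies_adj n).
Proof. by move=> x; rewrite /copies_adj adj_irrefl andbF. Qed.
Definition copies (n : nat) : sgraph :=
  SGraph (@copies_sym n) (@copies_irrefl n).

Definition pendant_adj (v : G) : rel (option G) := fun x y =>
  match x, y with
  | Some u, Some w => adj u w
  | Some u, None => u == v
  | None, Some w => w == v
  | None, None => false
  end.
Lemma pendant_sym v : symmetric (@pendant_adj v).
Proof. by case=> [x|] [y|] //=; rewrite adj_sym. Qed.
Lemma pendant_irrefl v : irreflexive (@pendant_adj v).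
Proof. by case=> [x|] //=; rewrite adj_irrefl. Qed.
(* [None] is a new vertex, whose only neighbour is [v]. *)
Definition pendant (v : G) : sgraph :=
  SGraph (@pendant_sym v) (@pendant_irrefl v).

End Operations.

Definition gjoin (G H : sgraph) : sgraph := compl (dunion (compl G) (compl H)).

Definition complete_adj (n : nat) : rel 'I_n := fun i j => i != j.
Lemma complete_sym n : symmetric (@complete_adj n).
Proof. by move=> i j; rewrite /complete_adj eq_sym. Qed.
Lemma complete_irrefl n : irreflexive (@complete_adj n).
Proof. by move=> i; rewrite /complete_adj eqxx. Qed.
Definition complete (n : nat) : sgraph :=
  SGraph (@complete_sym n) (@complete_irrefl n).

Definition path_adj (n : nat) : rel 'I_n :=
  fun i j => (i.+1 == j :> nat) || (j.+1 == i :> nat).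
Lemma path_sym n : symmetric (@path_adj n).
Proof. by move=> i j; rewrite /path_adj orbC. Qed.
Lemma path_irrefl n : irreflexive (@path_adj n).
Proof. by move=> i; rewrite /path_adj orbb eqn_leq ltnn. Qed.
(* The path on [n] vertices. *)
Definition path_graph (n : nat) : sgraph :=
  SGraph (@path_sym n) (@path_irrefl n).

(* For [n >= 3] the conjunct [i != j] is redundant; it only rules out a loop
   when [n = 1]. *)
Definition cycle_adj (n : nat) : rel 'I_n := fun i j =>
  (i != j) && ((i.+1 %% n == j :> nat) || (j.+1 %% n == i :> nat)).
Lemma cycle_sym n : symmetric (@cycle_adj n).
Proof. by move=> i j; rewrite /cycle_adj eq_sym orbC. Qed.
Lemma cycle_irrefl n : irreflexive (@cycle_adj n).
Proof. by move=> i; rewrite /cycle_adj eqxx. Qed.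
Definition cycle_graph (n : nat) : sgraph :=
  SGraph (@cycle_sym n) (@cycle_irrefl n).

Definition banner : sgraph := @pendant (cycle_graph 4) ord0.

(* The blocks of [P] are the parts, whose number is arbitrary (zero for the
   null graph). *)
Definition complete_multipartite (G : sgraph) : Prop :=
  exists2 P : {set {set G}}, partition P [set: G] &
    forall x y : G, adj x y = (pblock P x != pblock P y).

(* The blocks of [P] are the vertex sets of the complete graphs. *)
Definition cluster (G : sgraph) : Prop :=
  exists2 P : {set {set G}}, partition P [set: G] &
    forall x y : G, adj x y = (x != y) && (pblock P x == pblock P y).

Definition polar (G : sgraph) : Prop :=
  exists A : {set G},
    complete_multipartite (induced A) /\ cluster (induced (~: A)).

Definition minimal_polar_obstruction (G : sgraph) : Prop :=
  ~ polar G /\ forall S : {set G}, S \proper [set: G] -> polar (induced S).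

Definition induces_P4 (G : sgraph) (W : {set G}) : Prop :=
  iso (induced W) (path_graph 4).

Definition P4_sparse (G : sgraph) : Prop :=
  forall S W1 W2 : {set G}, #|S| = 5 ->
    W1 \subset S -> W2 \subset S -> induces_P4 W1 -> induces_P4 W2 -> W1 = W2.

(* [v] belongs to a P4 sharing vertices with [W]. *)
Definition in_P4_meeting (G : sgraph) (W : {set G}) (v : G) : Prop :=
  exists W' : {set G}, [/\ induces_P4 W', v \in W' & W :&: W' != set0].

Definition P4_extendible (G : sgraph) : Prop :=
  forall W : {set G}, induces_P4 W ->
    forall u v : G, u \notin W -> v \notin W ->
      in_P4_meeting W u -> in_P4_meeting W v -> u = v.

(* Main.v *)
(* Call a vertex set monopolar if it splits into a stable set and a cluster.  In a
   disconnected graph a complete multipartite part that is not stable lies in a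
   single component.  Hence a disconnected minimal polar obstruction is the
   disjoint union of P3, the obstruction to being a cluster, and a minimal
   non-monopolar graph, and the point is to show that the latter is the
   complement of one of the seven graphs E.

   If the graph is a join, this is a direct analysis, which rests on the theorem
   of Foldes and Hammer that a graph without induced 2K2, C4 and C5 is split.  If
   it is connected with connected complement, then every P4 of a P4-sparse or
   P4-extendible graph lies in a module that consists of a core containing the
   P4, of the form K + S with K multipartite and S a cluster, and of a head
   complete to K and anticomplete to S, or that is monopolar with five vertices.
   A largest such module is the whole
   graph, and then a polar partition of the head extends to the graph, while the
   graph is monopolar unless it contains one of the seven complements. *)

Require Import Defs.
From Stdlib Require List.
From Stdlib Require Import Classical.
From mathcomp Require Import all_boot.

Set Implicit Arguments.
Unset Strict Implicit.
Unset Printing Implicit Defensive.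

(** * Polar and monopolar vertex sets *)

(** The case distinction disconnected, co-disconnected, neither is made twice: for the obstruction
    itself, and for a minimal non-monopolar set inside one side of it. Polarity is invariant under
    complementation but monopolarity is not, so in the second use unions and joins need separate
    arguments. The remaining case must serve both uses, which is why [outcome] is a conjunction.

    The obstruction is never determined directly. Once a copy of P3 plus the complement of some E is
    found in it, minimality leaves no room for a further vertex, because that copy is itself not
    polar. This fact, and the minimality needed for the converse, come from exhaustive search.

    What makes a module grow is a P4 outside it whose midpoints are complete and whose ends are
    anticomplete to it: the module then looks like part of a head for that P4, and the module built
    around the P4 takes in every such vertex. *)

Section VertexSets.
Variable G : sgraph.
Implicit Types (x y z : G) (U V A B : {set G}).

Definition stable V := {in V &, forall x y, ~~ adj x y}.
Definition clique V := {in V &, forall x y, x != y -> adj x y}.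
Definition clu V :=
  {in V & &, forall x y z, adj x y -> adj y z -> x != z -> adj x z}.
Definition multip V :=
  {in V & &, forall x y z, ~~ adj x y -> ~~ adj y z -> ~~ adj x z}.

(* Overlapping covers may replace partitions: the four kinds of sets above are
   closed under taking subsets. [mono] stands for monopolar. *)
Definition covered (P Q : {set G} -> Prop) V :=
  exists A B, [/\ V \subset A :|: B, P A & Q B].
Definition pol := covered multip clu.
Definition mono := covered stable clu.
Definition split_set := covered stable clique.

Lemma covered_sub P Q V U : U \subset V -> covered P Q V -> covered P Q U.
Proof.
by move=> UV [A [B [sV PA QB]]]; exists A, B; split=> //; apply: subset_trans sV.
Qed.

Lemma stable_mul V : stable V -> multip V.
Proof. by move=> sV x y z xV yV zV _ _; apply: sV. Qed.

Lemma clique_clu V : clique V -> clu V.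
Proof. by move=> cV x y z xV yV zV _ _; apply: cV. Qed.

Lemma mono_pol V : mono V -> pol V.
Proof. by case=> A [B [? /stable_mul ? ?]]; exists A, B. Qed.

Lemma clu_sub U V : U \subset V -> clu V -> clu U.
Proof. by move=> /subsetP UV cV x y z /UV ? /UV ? /UV ?; apply: cV. Qed.

Lemma multip_sub U V : U \subset V -> multip V -> multip U.
Proof. by move=> /subsetP UV cV x y z /UV ? /UV ? /UV ?; apply: cV. Qed.

Lemma pol_disjoint V : pol V ->
  exists A : {set G}, [/\ A \subset V, multip A & clu (V :\: A)].
Proof.
case=> A [B [sV mA cB]]; exists (V :&: A); split; first exact: subsetIl.
- exact: multip_sub (subsetIr _ _) mA.
- apply: clu_sub cB; apply/subsetP=> x; rewrite !inE => /andP[].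
  by move=> + xV; move/subsetP/(_ x xV): sV; rewrite !inE xV => /orP[->|].
Qed.

Lemma equiv_partition (R : rel G) : equivalence_rel R ->
  exists2 P : {set {set G}}, partition P [set: G] &
    forall x y, (pblock P x == pblock P y) = R x y.
Proof.
move=> eR; have eR' : {in [set: G] & &, equivalence_rel R} by move=> *; apply: eR.
exists (equivalence_partition R [set: G]).
  exact: equivalence_partitionP.
have /and3P[/eqP cP tP _] := equivalence_partitionP eR'.
move=> x y; rewrite eq_pblock // ?cP ?inE //.
by rewrite pblock_equivalence_partition ?inE.
Qed.

Lemma cluster_clu : cluster G <-> clu [set: G].
Proof.
split=> [[P _ adjP] x y z _ _ _|cG].
  by rewrite !adjP => /andP[_ /eqP->] /andP[_ ->] ->.
have eR : equivalence_rel (fun x y => (x == y) || adj x y).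
  move=> x y z; split; first by rewrite eqxx.
  case/predU1P=> [->//|xy]; apply/predU1P/predU1P=> [[<-|xz]|[<-|yz]].
  - by right; rewrite adj_sym.
  - case: (eqVneq y z) => [|yz]; [by left | right].
    by apply: (cG y x z); rewrite ?inE // adj_sym.
  - by right.
  - by case: (eqVneq x z) => [|xz]; [left | right; apply: (cG x y z)].
have [P PP PE] := equiv_partition eR; exists P => // x y.
by rewrite PE; case: eqVneq => // ->; rewrite adj_irrefl.
Qed.

Lemma multipartite_mul : complete_multipartite G <-> multip [set: G].
Proof.
split=> [[P _ adjP] x y z _ _ _|mG].
  by rewrite !adjP !negbK => /eqP-> /eqP->.
have eR : equivalence_rel (fun x y => ~~ adj x y).
  move=> x y z; split; first by rewrite adj_irrefl.
  move=> xy; apply/idP/idP => xz; last by apply: (mG x y z); rewrite ?inE.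
  by apply: (mG y x z); rewrite ?inE // adj_sym.
have [P PP PE] := equiv_partition eR; exists P => // x y.
by rewrite PE negbK.
Qed.

End VertexSets.
Arguments clu : clear implicits.
Arguments multip : clear implicits.
Arguments pol : clear implicits.
Arguments mono : clear implicits.
Arguments stable : clear implicits.
Arguments clique : clear implicits.

Lemma cluster_induced (G : sgraph) (A : {set G}) :
  cluster (induced A) <-> clu G A.
Proof.
rewrite cluster_clu; split=> cA.
  move=> x y z xA yA zA.
  by apply: (cA (Sub x xA) (Sub y yA) (Sub z zA)); rewrite inE.
by move=> [x xA] [y yA] [z zA] _ _ _ /=; apply: cA.
Qed.

Lemma multipartite_induced (G : sgraph) (A : {set G}) :
  complete_multipartite (induced A) <-> multip G A.
Proof.
rewrite multipartite_mul; split=> mA.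
  move=> x y z xA yA zA.
  by apply: (mA (Sub x xA) (Sub y yA) (Sub z zA)); rewrite inE.
by move=> [x xA] [y yA] [z zA] _ _ _ /=; apply: mA.
Qed.

Lemma polarP (G : sgraph) : polar G <-> pol G [set: G].
Proof.
split=> [[A [/multipartite_induced mA /cluster_induced cA]]|].
  by exists A, (~: A); split=> //; rewrite setUCr.
case/pol_disjoint=> A [_ mA cA]; exists A; rewrite -setTD.
by split; [apply/multipartite_induced | apply/cluster_induced].
Qed.

Lemma polar_induced (G : sgraph) (S : {set G}) :
  polar (induced S) <-> pol G S.
Proof.
rewrite polarP; split=> [[A [B [/subsetP sT mA cB]]]|[A [B [/subsetP sT mA cB]]]].
  exists (val @: A), (val @: B); split.
  - apply/subsetP=> x xS; move: (sT (Sub x xS)); rewrite !inE.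
    by case/(_ isT)/orP=> /imset_f-/(_ _ val); rewrite SubK => ->; rewrite ?orbT.
  - move=> _ _ _ /imsetP[x xA ->] /imsetP[y yA ->] /imsetP[z zA ->].
    exact: (mA x y z).
  - move=> _ _ _ /imsetP[x xA ->] /imsetP[y yA ->] /imsetP[z zA ->].
    by move=> xy yz xz; apply: (cB x y z) => //; apply: contraNneq xz => ->.
exists (val @^-1: A), (val @^-1: B); split.
- by apply/subsetP=> x _; have := sT _ (valP x); rewrite !inE.
- by move=> x y z; rewrite !inE; apply: mA.
- move=> x y z; rewrite !inE -(inj_eq val_inj); apply: cB.
Qed.

(** Polarity is hereditary, so deleting single vertices suffices. *)
Lemma minobsP (G : sgraph) : minimal_polar_obstruction G <->
  ~ pol G [set: G] /\ forall x : G, pol G [set~ x].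
Proof.
split=> [[nG mG]|[nG mG]]; split; try by rewrite -?polarP // polarP.
- move=> x; apply/polar_induced/mG; apply/properP; split=> //.
  by exists x; rewrite !inE ?eqxx.
- move=> S /properP[_ [x _ xS]]; apply/polar_induced.
  apply: covered_sub (mG x); apply/subsetP=> y yS; rewrite !inE.
  by apply: contraNneq xS => <-.
Qed.

Lemma compl_adjE (G : sgraph) (x y : G) :
  @adj (compl G) x y = (x != y) && ~~ adj x y.
Proof. by []. Qed.

(** The double complement has the same vertex type but is another record, hence an equation between
    adjacencies. *)
Lemma compl_compl (G : sgraph) (x y : G) : @adj (compl (compl G)) x y = adj x y.
Proof.
rewrite compl_adjE [@adj (compl G) x y]compl_adjE negb_and !negbK.
by case: (eqVneq (x : G) y) => [->|] //=; rewrite adj_irrefl.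
Qed.

Lemma multip_compl (G : sgraph) (V : {set G}) : clu G V -> multip (compl G) V.
Proof.
move=> cV x y z xV yV zV; rewrite /= /compl_adj !negb_and !negbK.
case: eqVneq => [->//|_ /= xy].
case: eqVneq => [<-|_ /= yz]; first by rewrite xy orbT.
by case: eqVneq => //= xz; apply: cV yz xz.
Qed.

Lemma clu_compl (G : sgraph) (V : {set G}) : multip G V -> clu (compl G) V.
Proof.
move=> mV x y z xV yV zV /= /andP[_ xy] /andP[_ yz] xz.
by rewrite /compl_adj xz; apply: (mV x y z).
Qed.

Lemma pol_compl (G : sgraph) (V : {set G}) : pol G V -> pol (compl G) V.
Proof.
case=> A [B [sV mA cB]]; exists B, A; rewrite setUC; split=> //.
- exact: multip_compl.
- exact: clu_compl.
Qed.

Lemma pol_complE (G : sgraph) (V : {set G}) : pol (compl G) V <-> pol G V.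
Proof.
split=> [/pol_compl[A [B [sV mA cB]]]|]; last exact: pol_compl.
exists A, B; split=> //.
  by move=> x y z xA yA zA; have := mA x y z xA yA zA; rewrite !compl_compl.
by move=> x y z xA yA zA; have := cB x y z xA yA zA; rewrite !compl_compl.
Qed.

(** * Finite verifications *)

(** Lists replace finite sets here so that the search for a polar partition can be evaluated. *)
Fixpoint bipartitions (T : Type) (s : seq T) : seq (seq T * seq T) :=
  if s is x :: s' then
    let ps := bipartitions s' in
    [seq (x :: p.1, p.2) | p <- ps] ++ [seq (p.1, x :: p.2) | p <- ps]
  else [:: ([::], [::])].

Section Lists.
Variable G : sgraph.
Implicit Types (s : seq G).

Definition multipb s := all (fun x => all (fun y => adj x y ||
  all (fun z => adj y z || ~~ adj x z) s) s) s.
Definition club s := all (fun x => all (fun y => adj x y ==>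
  all (fun z => adj y z ==> (x != z) ==> adj x z) s) s) s.
Definition polb s := has (fun p => multipb p.1 && club p.2) (bipartitions s).

Lemma multipbP s : reflect (multip G [set x in s]) (multipb s).
Proof.
apply: (iffP allP) => [h x y z|h x xs].
  rewrite !inE => /h/allP hx /hx + zs xy yz.
  by rewrite (negPf xy) => /allP/(_ z zs); rewrite (negPf yz).
apply/allP=> y ys; case: (boolP (adj x y)) => //= xy; apply/allP=> z zs.
by case: (boolP (adj y z)) => //=; apply: h; rewrite ?inE.
Qed.

Lemma clubP s : reflect (clu G [set x in s]) (club s).
Proof.
apply: (iffP allP) => [h x y z|h x xs].
  rewrite !inE => /h/allP hx /hx + zs xy yz xz.
  by rewrite xy /= => /allP/(_ z zs); rewrite yz xz.
apply/allP=> y ys; apply/implyP=> xy; apply/allP=> z zs.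
by apply/implyP=> yz; apply/implyP=> xz; apply: (h x y z); rewrite ?inE.
Qed.

Lemma bipartitions_cover (A B : {set G}) s :
  [set x in s] \subset A :|: B -> exists2 p, p \in bipartitions s &
  [set x in p.1] \subset A /\ [set x in p.2] \subset B.
Proof.
elim: s => [|x s IHs] sAB.
  by exists ([::], [::]) => //=; split; apply/subsetP=> y; rewrite inE.
have [|p ps [pA pB]] := IHs.
  apply: subset_trans sAB; apply/subsetP=> y.
  by rewrite !inE => ->; rewrite orbT.
have : x \in A :|: B by apply: (subsetP sAB); rewrite !inE eqxx.
rewrite inE => /orP[xA|xB]; [exists (x :: p.1, p.2)|exists (p.1, x :: p.2)].
- by rewrite /= mem_cat map_f.
- by split=> //=; rewrite set_cons subUset sub1set xA.
- by rewrite /= mem_cat (map_f (fun q => (q.1, x :: q.2))) ?orbT.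
- by split=> //=; rewrite set_cons subUset sub1set xB.
Qed.

Lemma bipartitionsP s p : p \in bipartitions s ->
  [set x in s] \subset [set x in p.1] :|: [set x in p.2].
Proof.
elim: s p => [|x s IHs] p /=.
  by move=> _; apply/subsetP=> y; rewrite inE.
rewrite mem_cat => /orP[] /mapP[q /IHs/subsetP qs ->]; apply/subsetP=> y /=;
  rewrite !inE => /predU1P[->|ys]; rewrite ?eqxx ?orbT //.
  by have := qs y; rewrite !inE -orbA => ->; rewrite ?orbT.
by have := qs y; rewrite !inE orbCA => ->; rewrite ?orbT.
Qed.

Lemma polbP s : reflect (pol G [set x in s]) (polb s).
Proof.
apply: (iffP hasP) => [[p ps /andP[/multipbP m /clubP c]]|[A [B [sAB mA cB]]]].
  by exists [set x in p.1], [set x in p.2]; split=> //; apply: bipartitionsP.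
have [p ps [pA pB]] := bipartitions_cover sAB; exists p => //.
apply/andP; split; first exact/multipbP/(multip_sub pA).
exact/clubP/(clu_sub pB).
Qed.

Lemma listing_full s : uniq s -> size s = #|G| -> forall x, x \in s.
Proof.
move=> us ss x; have cs : #|s| = #|G| by rewrite (card_uniqP us).
by move/subset_cardP: cs => /(_ (subset_predT _)) ->.
Qed.

Lemma minobs_list s : uniq s -> size s = #|G| ->
  ~~ polb s && all (fun x => polb [seq y <- s | y != x]) s ->
  minimal_polar_obstruction G.
Proof.
move=> us ss; have fs := listing_full us ss.
case/andP=> /polbP nG /allP mG; apply/minobsP; split=> [gG|x].
  by apply: nG; apply: covered_sub gG; apply: subsetT.
apply: covered_sub (polbP _ (mG x (fs x))); apply/subsetP=> y.
by rewrite !inE mem_filter fs andbT.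
Qed.

End Lists.

Definition obstruction_parts : seq sgraph :=
  [:: dunion (complete 1) (copies (complete 2) 2);
      copies (path_graph 3) 2;
      dunion (copies (complete 1) 2) (cycle_graph 4);
      dunion (complete 1) (compl (dunion (path_graph 3) (complete 2)));
      dunion (complete 1) (cycle_graph 5);
      dunion (complete 1) banner;
      dunion (complete 1) (compl (path_graph 5))].

(** Takes the place of [enum] in the evaluated checks; structural recursion lets it compute. *)
Fixpoint ords n : seq 'I_n :=
  if n is m.+1 then ord0 :: map (lift ord0) (ords m) else [::].

Section Products.
Variables S T : Type.
Implicit Types (s : seq S) (t : seq T).
Definition lsum s t : seq (S + T) := map inl s ++ map inr t.
Definition lprod s t : seq (S * T) := [seq (x, y) | x <- s, y <- t].
Definition lopt s : seq (option S) := None :: map Some s.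
End Products.

Definition list1 : seq (dunion (complete 1) (copies (complete 2) 2)) :=
  lsum (ords 1) (lprod (ords 2) (ords 2)).
Definition list2 : seq (copies (path_graph 3) 2) := lprod (ords 2) (ords 3).
Definition list3 : seq (dunion (copies (complete 1) 2) (cycle_graph 4)) :=
  lsum (lprod (ords 2) (ords 1)) (ords 4).
Definition list4 :
    seq (dunion (complete 1) (compl (dunion (path_graph 3) (complete 2)))) :=
  lsum (ords 1) (lsum (ords 3) (ords 2)).
Definition list5 : seq (dunion (complete 1) (cycle_graph 5)) :=
  lsum (ords 1) (ords 5).
Definition list6 : seq (dunion (complete 1) banner) :=
  lsum (ords 1) (lopt (ords 4)).
Definition list7 : seq (dunion (complete 1) (compl (path_graph 5))) :=
  lsum (ords 1) (ords 5).

Lemma minobs_join_list (E : sgraph) (t : seq E) : size t = #|E| ->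
  (let s : seq (gjoin (compl (path_graph 3)) E) := lsum (ords 3) t in
   [&& uniq s, ~~ polb s & all (fun x => polb [seq y <- s | y != x]) s]) ->
  minimal_polar_obstruction (gjoin (compl (path_graph 3)) E).
Proof.
move=> tE /andP[us ok]; apply: minobs_list us _ ok.
by rewrite size_cat !size_map tE card_sum card_ord.
Qed.

(** The graphs have eight or nine vertices, so each polarity test ranges over at most 2^9
    bipartitions. *)
Ltac brute_force l := apply: (@minobs_join_list _ l);
  [ by rewrite ?(card_sum, card_prod, card_option, card_ord)
  | vm_cast_no_check (erefl true) ].

Lemma minobs_join E : List.In E obstruction_parts ->
  minimal_polar_obstruction (gjoin (compl (path_graph 3)) E).
Proof.
case=> [<-|]; first by brute_force list1.
case=> [<-|]; first by brute_force list2.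
case=> [<-|]; first by brute_force list3.
case=> [<-|]; first by brute_force list4.
case=> [<-|]; first by brute_force list5.
case=> [<-|]; first by brute_force list6.
by case=> [<-|[]]; brute_force list7.
Qed.

(** * Induced copies *)

Definition embedding (H G : sgraph) (f : H -> G) :=
  injective f /\ forall x y, adj (f x) (f y) = adj x y.

Lemma pol_embedding (H G : sgraph) (f : H -> G) (V : {set G}) :
  embedding f -> pol G V -> pol H (f @^-1: V).
Proof.
move=> [fI fA] [A [B [sV mA cB]]]; exists (f @^-1: A), (f @^-1: B); split.
- by rewrite -preimsetU; apply: preimsetS.
- by move=> x y z; rewrite !inE -!fA; apply: mA.
- by move=> x y z; rewrite !inE -!fA -(inj_eq fI); apply: cB.
Qed.

(* The adjacency matrix of a list of vertices, row by row above the diagonal. *)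
Fixpoint edge_code (G : sgraph) (s : seq G) : seq bool :=
  if s is x :: s' then map (adj x) s' ++ edge_code s' else [::].

Lemma edge_code_nth (G H : sgraph) (s : seq G) (t : seq H) x0 y0 :
  size s = size t -> edge_code s = map negb (edge_code t) ->
  forall i j, i < j -> j < size s ->
  adj (nth x0 s i) (nth x0 s j) = ~~ adj (nth y0 t i) (nth y0 t j).
Proof.
elim: s t => [|x s IHs] [|y t] //= [st]; rewrite map_cat => /eqP.
rewrite eqseq_cat ?size_map // => /andP[/eqP xy /eqP E].
case=> [|i] [|j] //= ij js; last exact: IHs.
have := congr1 (nth false ^~ j) xy; rewrite -map_comp.
by rewrite (nth_map x0) // (nth_map y0) // -st.
Qed.

(** The code of [t] is negated because it is the complement of [E] that embeds; the map sends each
    vertex to the entry of [x0 :: s] at its position in [t]. *)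
Lemma embedding_list (E G : sgraph) (t : seq E) (x0 : G) (s : seq G) :
  uniq t -> size t = #|E| -> uniq (x0 :: s) -> size (x0 :: s) = size t ->
  edge_code (x0 :: s) = map negb (edge_code t) ->
  exists f : compl E -> G, embedding f.
Proof.
move=> ut tE us st code; have ft := listing_full ut tE.
pose f (x : compl E) := nth x0 (x0 :: s) (index (x : E) t).
have fi (x : E) : index x t < size (x0 :: s) by rewrite st index_mem.
exists f; split=> [x y /eqP|x y].
  by rewrite nth_uniq // => /eqP /(congr1 (nth (x : E) t)); rewrite !nth_index.
rewrite compl_adjE; have code_nth := edge_code_nth x0 (x : E) st code.
case: (ltngtP (index (x : E) t) (index (y : E) t)) => ij.
- rewrite code_nth // !nth_index //; case: (eqVneq (x : E) y) => // exy.
  by rewrite exy ltnn in ij.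
- rewrite adj_sym code_nth // !nth_index // adj_sym.
  by case: (eqVneq (x : E) y) => // exy; rewrite exy ltnn in ij.
- rewrite /f ij adj_irrefl; move/(congr1 (nth (x : E) t)): ij.
  by rewrite !nth_index // => ->; rewrite eqxx.
Qed.

(* Monopolarity is lost exactly through these graphs: a minimal polar
   obstruction [G] has to be, up to complementation, [P3 + compl E]. *)
Definition has_part (G : sgraph) := exists2 E, List.In E obstruction_parts &
  exists f : compl E -> G, embedding f.

Lemma embedding_comp (H G K : sgraph) (f : H -> G) (g : G -> K) :
  embedding f -> embedding g -> embedding (g \o f).
Proof.
case=> fI fA [gI gA]; split=> [|x y]; first exact: inj_comp.
by rewrite /= gA fA.
Qed.

Lemma has_part_embedding (H G : sgraph) (f : H -> G) :
  embedding f -> has_part H -> has_part G.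
Proof.
move=> ef [E inE [g eg]]; exists E => //.
by exists (f \o g); apply: embedding_comp.
Qed.

(** If [f] missed a vertex, that vertex could be deleted from [G], and [H] would inherit the
    polarity of the rest. So [f] is onto. *)
Lemma embedding_obstruction (H G : sgraph) (f : H -> G) :
  embedding f -> ~ pol H [set: H] -> minimal_polar_obstruction G -> iso G H.
Proof.
move=> ef nH /minobsP[_ mG]; have [fI fA] := ef.
have fS y : y \in codom f.
  apply: contraPT nH => yf; apply; apply: covered_sub (pol_embedding ef (mG y)).
  apply/subsetP=> x _; rewrite !inE.
  by apply: contraNneq yf => <-; apply: codom_f.
have g_ y : {x | f x = y} by exists (iinv (fS y)); rewrite f_iinv.
pose g y := sval (g_ y).
have fg : cancel g f by move=> y; apply: (svalP (g_ y)).
exists g; last by move=> x y; rewrite -fA !fg.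
by exists f => // x; apply: fI.
Qed.

Section Parts.
Variable G : sgraph.
Implicit Types (u v w x y z a b c d e : G).

(** In this and the next lemmas the vertices come in the order of the listing of [E], not in the
    natural order of its complement. Here the rim of the wheel is a, c, b, d; in [has_wheel5] it is
    a, c, e, b, d; in [has_K2_join_2K2] the two edges are ac and bd; in [has_K1_join_co_banner] the
    vertex [w] misses only [a] of the 2K2 formed by ac and bd. *)
Lemma has_wheel4 u a b c d : uniq [:: u; a; b; c; d] ->
  edge_code [:: u; a; b; c; d] =
    [:: true; true; true; true; false; true; true; true;
        true; false] ->
  has_part G.
Proof.
move=> us code; eexists; first by left.
by apply: (embedding_list (t := list1)) us _ code => //;
  rewrite ?(card_sum, card_prod, card_option, card_ord).
Qed.

Lemma has_co_2P3 x y z a b c : uniq [:: x; y; z; a; b; c] ->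
  edge_code [:: x; y; z; a; b; c] =
    [:: false; true; true; true; true; false; true; true;
        true; true; true; true; false; true; false] ->
  has_part G.
Proof.
move=> us code; eexists; first by do 1 right; left.
by apply: (embedding_list (t := list2)) us _ code => //;
  rewrite ?(card_sum, card_prod, card_option, card_ord).
Qed.

Lemma has_K2_join_2K2 u v a b c d : uniq [:: u; v; a; b; c; d] ->
  edge_code [:: u; v; a; b; c; d] =
    [:: true; true; true; true; true; true; true; true;
        true; false; true; false; false; true; false] ->
  has_part G.
Proof.
move=> us code; eexists; first by do 2 right; left.
by apply: (embedding_list (t := list3)) us _ code => //;
  rewrite ?(card_sum, card_prod, card_option, card_ord).
Qed.

Lemma has_K1_join_P3_K2 u x y z a b : uniq [:: u; x; y; z; a; b] ->
  edge_code [:: u; x; y; z; a; b] =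
    [:: true; true; true; true; true; true; false; false;
        false; true; false; false; false; false; true] ->
  has_part G.
Proof.
move=> us code; eexists; first by do 3 right; left.
by apply: (embedding_list (t := list4)) us _ code => //;
  rewrite ?(card_sum, card_prod, card_option, card_ord).
Qed.

Lemma has_wheel5 u a b c d e : uniq [:: u; a; b; c; d; e] ->
  edge_code [:: u; a; b; c; d; e] =
    [:: true; true; true; true; true; false; true; true;
        false; false; true; true; false; true; false] ->
  has_part G.
Proof.
move=> us code; eexists; first by do 4 right; left.
by apply: (embedding_list (t := list5)) us _ code => //;
  rewrite ?(card_sum, card_prod, card_option, card_ord).
Qed.

Lemma has_K1_join_co_banner u w a b c d : uniq [:: u; w; a; b; c; d] ->
  edge_code [:: u; w; a; b; c; d] =
    [:: true; true; true; true; true; false; true; true;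
        true; false; true; false; false; true; false] ->
  has_part G.
Proof.
move=> us code; eexists; first by do 5 right; left.
by apply: (embedding_list (t := list6)) us _ code => //;
  rewrite ?(card_sum, card_prod, card_option, card_ord).
Qed.

Lemma has_K1_join_P5 u a b c d e : uniq [:: u; a; b; c; d; e] ->
  edge_code [:: u; a; b; c; d; e] =
    [:: true; true; true; true; true; true; false; false;
        false; true; false; false; true; false; true] ->
  has_part G.
Proof.
move=> us code; eexists; first by do 6 right; left.
by apply: (embedding_list (t := list7)) us _ code => //;
  rewrite ?(card_sum, card_prod, card_option, card_ord).
Qed.

End Parts.

(** * Split graphs *)

Ltac adj_simpl := repeat match goal with
  | H : is_true (adj ?x ?y) |- context [adj ?x ?y] => rewrite H
  | H : is_true (adj ?x ?y) |- context [adj ?y ?x] => rewrite (adj_sym y x) H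
  | H : is_true (~~ adj ?x ?y) |- context [adj ?x ?y] => rewrite (negPf H)
  | H : is_true (~~ adj ?x ?y) |- context [adj ?y ?x] =>
      rewrite (adj_sym y x) (negPf H)
  | |- context [adj ?x ?x] => rewrite adj_irrefl
  | |- context [?x == ?x] => rewrite eqxx
  | H : is_true (?x != ?y) |- context [?x == ?y] => rewrite (negPf H)
  | H : is_true (?x != ?y) |- context [?y == ?x] =>
      rewrite (eq_sym y x) (negPf H)
  end.

Section Induced.
Variable G : sgraph.
Implicit Types (a b c d e v x y z h : G) (U V H A B K S : {set G}).

Lemma adj_neq x y : adj x y -> x != y.
Proof. by apply: contraTneq => ->; rewrite adj_irrefl. Qed.

Lemma adj_sep z x y : adj x z -> ~~ adj y z -> x != y.
Proof. by move=> xz; apply: contraNneq => <-. Qed.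

Lemma adj_sepr z x y : ~~ adj x z -> adj y z -> x != y.
Proof. by move=> xz; apply: contraTneq => <-. Qed.

Definition two_K2 a b c d :=
  [&& adj a b, adj c d, ~~ adj a c, ~~ adj a d, ~~ adj b c & ~~ adj b d].
(** Opposite vertices have the same neighbours on the cycle, so their distinctness cannot be read
    off from adjacencies and is demanded. *)
Definition four_cycle a b c d :=
  [&& adj a b, adj b c, adj c d & adj d a] &&
  [&& a != c, b != d, ~~ adj a c & ~~ adj b d].
Definition five_cycle a b c d e :=
  [&& adj a b, adj b c, adj c d, adj d e & adj e a] &&
  [&& ~~ adj a c, ~~ adj a d, ~~ adj b d, ~~ adj b e & ~~ adj c e].
Definition p4 a b c d :=
  [&& adj a b, adj b c, adj c d, ~~ adj a c, ~~ adj b d & ~~ adj a d].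

Definition inside V (s : seq G) := {subset s <= V}.

Definition nonsplit_config V :=
  [\/ exists a b c d, inside V [:: a; b; c; d] /\ two_K2 a b c d,
      exists a b c d, inside V [:: a; b; c; d] /\ four_cycle a b c d
    | exists a b c d e, inside V [:: a; b; c; d; e] /\ five_cycle a b c d e].

Lemma inside_cons V x s : x \in V -> inside V s -> inside V (x :: s).
Proof. by move=> xV sV y; rewrite inE => /predU1P[->|/sV]. Qed.

Lemma inside_nil V : inside V [::].
Proof. by []. Qed.

Lemma stableU1 v A : stable G A -> {in A, forall x, ~~ adj v x} ->
  stable G (v |: A).
Proof.
move=> sA vA x y /setU1P[->|xA] /setU1P[->|yA].
- by rewrite adj_irrefl.
- exact: vA.
- by rewrite adj_sym vA.
- exact: sA.
Qed.

Lemma cliqueU1 v A : clique G A -> {in A, forall x, adj v x} ->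
  clique G (v |: A).
Proof.
move=> cA vA x y /setU1P[->|xA] /setU1P[->|yA].
- by rewrite eqxx.
- by move=> _; apply: vA.
- by move=> _; rewrite adj_sym vA.
- exact: cA.
Qed.

Lemma stable_sub U V : U \subset V -> stable G V -> stable G U.
Proof. by move=> /subsetP UV sV x y /UV ? /UV ?; apply: sV. Qed.

Lemma clique_sub U V : U \subset V -> clique G V -> clique G U.
Proof. by move=> /subsetP UV sV x y /UV ? /UV ?; apply: sV. Qed.

(** If some [s] of the stable side is complete to the clique, a single move of [s] to the clique is
    enough: [s] is then a missed vertex for all others of the stable side. *)
Lemma split_maximal V : split_set V -> exists K S : {set G},
  [/\ V = K :|: S, clique G K, stable G S &
      forall s, s \in S -> s \notin K /\ exists2 k, k \in K & ~~ adj s k].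
Proof.
case=> A [B [sV stA clB]]; pose K := V :&: B; pose S := V :\: B.
have clK : clique G K by apply: clique_sub clB; apply: subsetIr.
have stS : stable G S.
  apply: stable_sub stA; apply/subsetP=> x; rewrite !inE => /andP[xB xV].
  by move/subsetP/(_ x xV): sV; rewrite !inE (negPf xB) orbF.
have VE : V = K :|: S by rewrite setID.
have dKS s : s \in S -> s \notin K.
  by rewrite !inE => /andP[/negPf->]; rewrite andbF.
clearbody K S.
case: (classic (forall s, s \in S -> exists2 k, k \in K & ~~ adj s k)) => [h|].
  by exists K, S; split=> // s sS; split; auto.
move=> /not_all_ex_not[s nh]; have [sS nk] := imply_to_and _ _ nh.
exists (s |: K), (S :\ s).
have sK : {in K, forall k, adj s k}.
  by move=> k kK; apply/negPn/negP => sk; apply: nk; exists k.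
split; last 1 first.
- move=> s'; rewrite !inE => /andP[s's s'S].
  rewrite negb_or s's (dKS _ s'S); split=> //; exists s; first exact: setU11.
  exact: stS.
- by rewrite VE setUAC setD1K // setUC.
- exact: cliqueU1.
- exact: stable_sub (subD1set _ _) stS.
Qed.

(* Foldes and Hammer. After removing a vertex [v], take a split partition such
   that no vertex of the stable side is complete to the clique; either [v] can
   be added, or exchanging [v] and one more vertex between the sides works. *)
Lemma split_or_config V : split_set V \/ nonsplit_config V.
Proof.
apply: NNPP => /not_or_and[nsV ncV]; case: nsV.
have [n leV] := ubnP #|V|; elim: n V ncV leV => // n IHn V ncV leV.
have [->|[v vV]] := set_0Vmem V.
  by exists set0, set0; split=> [|x y|x y]; rewrite ?sub0set ?inE.
have sV : V :\ v \subset V by apply: subD1set.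
have [|K [S [VE clK stS Snk]]] := @split_maximal (V :\ v).
  apply: IHn; last by rewrite (cardsD1 v) vV in leV.
  case=> [[a [b [c [d [inV C]]]]]|[a [b [c [d [inV C]]]]]|[a [b [c [d [e [inV C]]]]]]];
    apply: ncV; [apply: Or31; exists a, b, c, d|apply: Or32; exists a, b, c, d|
    apply: Or33; exists a, b, c, d, e]; by split=> // x /inV /(subsetP sV).
have KV k : k \in K -> k \in V.
  by move=> kK; apply: (subsetP sV); rewrite VE inE kK.
have SV s : s \in S -> s \in V.
  by move=> sS; apply: (subsetP sV); rewrite VE inE sS orbT.
have VU : V = v |: (K :|: S) by rewrite -VE setD1K.
have [vK|] := classic {in K, forall k, adj v k}.
  exists S, (v |: K); split=> //; last exact: cliqueU1.
  by rewrite VU [S :|: _]setUC setUA.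
move=> /not_all_ex_not[k1 nh]; have [k1K /negP vk1] := imply_to_and _ _ nh; clear nh.
have [vS|] := classic {in S, forall s, ~~ adj v s}.
  exists (v |: S), K; split=> //; last exact: stableU1.
  by rewrite VU -setUA [S :|: _]setUC.
move=> /not_all_ex_not[s nh]; have [sS /negP] := imply_to_and _ _ nh; clear nh.
rewrite negbK => vs.
have vK k : k \in K -> v != k.
  move=> kK; have : k \in V :\ v by rewrite VE inE kK.
  by rewrite !inE eq_sym => /andP[].
have vS' s' : s' \in S -> v != s'.
  move=> s'S; have : s' \in V :\ v by rewrite VE inE s'S orbT.
  by rewrite !inE eq_sym => /andP[].
have SK s' : s' \in S -> s' \notin K by move=> /Snk[].
have ins x q : x \in V -> inside V q -> inside V (x :: q) by apply: inside_cons.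
(* Otherwise v, s', k0, k' is an induced C4. In the next two claims the edge from v to s1 would form
   a 2K2 with an edge at k. *)
have claim1 s' k0 k' : s' \in S -> k0 \in K -> k' \in K -> adj v s' ->
    ~~ adj v k0 -> adj s' k0 -> adj v k' -> adj s' k'.
  move=> s'S k0K k'K vs' vk0 s'k0 vk'; apply/negPn/negP=> s'k'; apply: ncV.
  have k0k' : adj k0 k'.
    by apply: clK => //; apply: contraNneq vk0 => ->.
  have s'Dk' : s' != k' by apply: contraNneq (SK _ s'S) => ->.
  apply: Or32; exists v, s', k0, k'; split; first by auto 10 using inside_nil.
  by rewrite /four_cycle vK //; adj_simpl.
have claim2 s1 s2 k : s1 \in S -> s2 \in S -> k \in K -> adj v s1 ->
    ~~ adj v k -> ~~ adj s1 k -> ~~ adj v s2 -> ~~ adj s2 k.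
  move=> s1S s2S kK vs1 vk s1k vs2; apply/negP=> s2k; apply: ncV; apply: Or31.
  exists v, s1, k, s2; split; first by auto 10 using inside_nil.
  by rewrite /two_K2 (negPf (stS _ _ s1S s2S)); adj_simpl.
have claim3 s1 k k' : s1 \in S -> k \in K -> k' \in K -> k != k' -> adj v s1 ->
    ~~ adj v k -> ~~ adj v k' -> ~~ adj s1 k -> adj s1 k'.
  move=> s1S kK k'K kk' vs1 vk vk' s1k; apply/negPn/negP=> s1k'; apply: ncV.
  apply: Or31; exists v, s1, k, k'; split; first by auto 10 using inside_nil.
  by rewrite /two_K2 (clK k k') //; adj_simpl.
(* If [k1] is the only vertex of [K] missed by [v], then no vertex of [S] sees [k1], and [v] takes
   its place in the clique. *)
have [|] := classic (forall k, k \in K -> ~~ adj v k -> k = k1) => [K1|].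
  have s'k1 s' : s' \in S -> ~~ adj s' k1.
    have S1 s1 : s1 \in S -> adj v s1 -> ~~ adj s1 k1.
      move=> s1S vs1; apply/negP=> s1k1; have [_ [k kK /negP[]]] := Snk _ s1S.
      have [vk|/K1->//] := boolP (adj v k).
      by apply: claim1 s1k1 vk.
    move=> s'S; have [/S1->//|vs'] := boolP (adj v s').
    have N := S1 _ sS vs. apply: (@claim2 s s' k1) => //.
  exists (k1 |: S), (v |: (K :\ k1)); split.
  - rewrite VU; apply/subsetP=> x; rewrite !inE.
    by case: (x == v); case: (x == k1); case: (x \in K); rewrite ?orbT //= orbF.
  - by apply: stableU1 => // s' /s'k1; rewrite adj_sym.
  - apply: cliqueU1; first by apply: clique_sub clK; apply: subD1set.
    by move=> k; rewrite !inE => /andP[kk1 kK]; apply: contraNT kk1 => /K1->.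
move=> /not_all_ex_not[k2 nh]; have [k2K nh'] := imply_to_and _ _ nh; clear nh.
have [vk2 /eqP k21] := imply_to_and _ _ nh'; clear nh'.
(* By [claim3], [s1] sees [k1] or [k2]. Then [claim1] makes it see all neighbours of [v] in [K], and
   [claim3] lets it miss only one of the other vertices. *)
have miss s1 : s1 \in S -> adj v s1 ->
    exists k, [/\ k \in K, ~~ adj v k, ~~ adj s1 k &
      forall k', k' \in K -> k' != k -> adj s1 k'].
  move=> s1S vs1; have [k0 [k0K vk0 s1k0]] :
      exists k0, [/\ k0 \in K, ~~ adj v k0 & adj s1 k0].
    have [s1k1|s1k1] := boolP (adj s1 k1); first by exists k1.
    by exists k2; rewrite (claim3 s1 k1 k2) // eq_sym.
  have [_ [k kK s1k]] := Snk _ s1S.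
  have vk : ~~ adj v k by apply: contraNN s1k => vk; apply: claim1 s1k0 vk.
  exists k; split=> // k' k'K kk'; have [vk'|vk'] := boolP (adj v k').
    by apply: claim1 s1k0 vk'.
  by apply: claim3 vs1 vk vk' s1k; rewrite // eq_sym.
have [k [kK vk sk sK]] := miss _ sS vs.
(* Two neighbours of [v] in [S] give a C5 if they miss different vertices of [K], and a C4 through a
   common neighbour [k0] if they miss the same one. *)
have S1 s' : s' \in S -> adj v s' -> s' = s.
  move=> s'S vs'; apply/eqP/negPn/negP=> ss'.
  have sNs' := stS _ _ sS s'S.
  have [k' [k'K vk' s'k' s'K]] := miss _ s'S vs'; apply: ncV.
  have [kk'|kk'] := eqVneq k' k; last first.
    apply: Or33; exists v, s, k', k, s'; split; first by auto 10 using inside_nil.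
    have sk2 : adj s k' by apply: sK.
    have sk3 : adj s' k by apply: s'K => //; rewrite eq_sym.
    by rewrite /five_cycle (clK k' k) //; adj_simpl.
  subst k'.
  have [k0 [k0K vk0 k0k]] : exists k0, [/\ k0 \in K, ~~ adj v k0 & k0 != k].
    by have [E|E] := eqVneq k1 k; [exists k2; rewrite -E | exists k1].
  have sk0 : adj s k0 by apply: sK.
  have s'k0 : adj s' k0 by apply: s'K.
  apply: Or32; exists v, s, k0, s'; split; first by auto 10 using inside_nil.
  by rewrite /four_cycle vK // (eq_sym s); adj_simpl.
(* [s] and [k] change sides and [v] becomes stable. *)
exists (v |: (k |: (S :\ s))), (s |: (K :\ k)); split.
- rewrite VU; apply/subsetP=> x; rewrite !inE.
  by case: (x == v); case: (x == k); case: (x == s); rewrite ?orbT //= orbC.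
- apply: stableU1; last first.
    move=> x; rewrite !inE => /predU1P[->//|/andP[xs xS]].
    by apply: contraNN xs => /(S1 _ xS)->.
  apply: stableU1; first by apply: stable_sub stS; apply: subD1set.
  move=> x; rewrite !inE => /andP[xs xS]; rewrite adj_sym.
  by apply: claim2 vs vk sk _ => //; apply: contraNN xs => /(S1 _ xS)->.
- apply: cliqueU1; first by apply: clique_sub clK; apply: subD1set.
  by move=> x; rewrite !inE => /andP[xk xK]; apply: sK.
Qed.

End Induced.

(** * Modules *)

Ltac adj_done := solve [adj_simpl; by []].
(** Vertices are told apart by being adjacent, or by a third vertex that sees just one of them. *)
Ltac neq_done x y := first
  [ solve [apply: adj_neq; adj_done]
  | match goal with z : _ |- _ =>
      solve [apply: (@adj_sep _ z); adj_done | apply: (@adj_sepr _ z); adj_done]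
    end ].
Ltac neq_simpl := repeat (adj_simpl; match goal with
  | |- context [?x == ?y] =>
      let N := fresh in have N : x != y by neq_done x y
  end); adj_simpl.

Definition disconnected (G : sgraph) := exists X : {set G},
  [/\ X != set0, X != [set: G] & forall x y, x \in X -> y \notin X -> ~~ adj x y].

Section Modules.
Variable G : sgraph.
Implicit Types (a b c d h n t x y : G) (H K S : {set G}).

Definition module H := forall x, x \notin H ->
  {in H, forall h, adj x h} \/ {in H, forall h, ~~ adj x h}.

Lemma disconnectedI (X : {set G}) x0 y0 : x0 \in X -> y0 \notin X ->
  (forall x y, x \in X -> y \notin X -> ~~ adj x y) -> disconnected G.
Proof.
move=> xX yX cX; exists X; split=> //; first by apply/set0Pn; exists x0.
by apply: contraNneq yX => ->; rewrite inE.
Qed.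

Lemma codisconnectedI (X : {set G}) x0 y0 : x0 \in X -> y0 \notin X ->
  (forall x y, x \in X -> y \notin X -> adj x y) -> disconnected (compl G).
Proof.
move=> xX yX cX; exists X; split=> //; first by apply/set0Pn; exists x0.
  by apply: contraNneq yX => ->; rewrite inE.
by move=> x y xX' yX'; rewrite compl_adjE cX // andbF.
Qed.

(* Let [T] and [N] be the vertices outside [H] complete and anticomplete to it.
   If [t] in [T] sees as many vertices of [N] as possible, then the missed vertices of
   [N] give the P4 or are separated from the rest; if none is missed, then the
   vertices of [T] complete to [N] are separated in the complement. *)
Lemma module_alternative H h0 : h0 \in H -> module H ->
  (forall h x y z, h \in H -> x \notin H -> y \notin H -> z \notin H ->
     ~~ p4 h x y z && ~~ p4 x y h z) ->
  [\/ H = [set: G], disconnected G, disconnected (compl G) |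
     exists n1 t1 t2 n2, p4 n1 t1 t2 n2 /\ {in H, forall h,
       [&& adj h t1, adj h t2, ~~ adj h n1 & ~~ adj h n2]}].
Proof.
move=> h0H mH noP4.
have [<-|HT] := eqVneq H setT; first exact: Or41.
have [y0 y0H] : exists y, y \notin H.
  by move: HT; rewrite -subTset => /subsetPn[y _ yH]; exists y.
pose T t := (t \notin H) && adj t h0; pose N n := (n \notin H) && ~~ adj n h0.
have TH t h : T t -> h \in H -> adj t h.
  by case/andP=> tH th0 hH; case: (mH t tH) => [->//|/(_ _ h0H)]; rewrite th0.
have NH n h : N n -> h \in H -> ~~ adj n h.
  by case/andP=> tH th0 hH; case: (mH n tH) => [/(_ _ h0H)|->//]; rewrite (negPf th0).
have HTN x : [|| x \in H, T x | N x].
  by rewrite /T /N; case: (x \in H); case: adj.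
have [t0 Tt0|T0] := pickP T; last first.
  apply: Or42; apply: (disconnectedI h0H y0H) => x y xH yH.
  by have := HTN y; rewrite T0 (negPf yH) adj_sym => /= /NH ->.
pose Nb t := [set n | N n && adj t n].
have [t Tt tmax] := @arg_maxnP _ t0 T (fun t => #|Nb t|) Tt0.
have [n1 /andP[Nn1 tn1]|tN] := pickP (fun n => N n && ~~ adj t n); last first.
  pose X := [set t' | T t' && [forall n, N n ==> adj t' n]].
  apply: Or43; apply: (@codisconnectedI X t h0).
  - rewrite inE Tt; apply/forallP=> n; apply/implyP=> Nn.
    by have := tN n; rewrite /= Nn => /negbFE.
  - by rewrite inE /T h0H.
  move=> x y; rewrite !inE => /andP[Tx /forallP xN].
  case/or3P: (HTN y) => [yH _|Ty|Ny _].
  - exact: TH.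
  - rewrite Ty => /forallPn[n]; rewrite negb_imply => /andP[Nn yn].
    have xn : adj x n by have := xN n; rewrite Nn.
    (* A non-edge between x and y would give the P4 n - x - h0 - y, which meets [H] only in h0. *)
    apply/negPn/negP => xy; have [nH _] := andP Nn; have [xH _] := andP Tx.
    have [yH _] := andP Ty; have /andP[_] := noP4 h0 n x y h0H nH xH yH.
    have := TH _ _ Tx h0H; have := TH _ _ Ty h0H; have := NH _ _ Nn h0H.
    by move=> nh yh xh; rewrite /p4; adj_simpl.
  - by have := xN y; rewrite Ny.
have [|noext] := classic (exists n1 t1 t2 n2, p4 n1 t1 t2 n2 /\ {in H, forall h,
  [&& adj h t1, adj h t2, ~~ adj h n1 & ~~ adj h n2]}); first exact: Or44.
apply: Or42; apply: (@disconnectedI [set n | N n && ~~ adj t n] n1 h0).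
- by rewrite inE Nn1.
- by rewrite inE /N h0H.
have [tH _] := andP Tt; have th := TH _ _ Tt h0H.
move=> x y; rewrite !inE => /andP[Nx tx]; have [xH _] := andP Nx.
have xh := NH _ _ Nx h0H.
case/or3P: (HTN y) => [yH _|Ty _|Ny].
- exact: NH.
(* [y] sees [x] and [t] does not, so by the choice of [t] some [n] is seen by [t] but not by [y].
   Either a P4 meets [H] only in [h0], or n - t - y - x is the P4 sought. *)
- apply/negP=> xy; have /subsetPn[n] : ~~ (Nb t \subset Nb y).
    apply/negP=> ty; have /eqP E : Nb t == Nb y.
      by rewrite eqEcard ty; apply: tmax.
    have : x \in Nb y by rewrite inE Nx adj_sym.
    by rewrite -E inE (negPf tx) andbF.
  rewrite !inE => /andP[Nn tn]; rewrite Nn /= => yn.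
  have [nH _] := andP Nn; have nh := NH _ _ Nn h0H.
  have [yH _] := andP Ty; have yh := TH _ _ Ty h0H.
  have [ty|ty] := boolP (adj t y); last first.
    have /andP[_] := noP4 h0 x y t h0H xH yH tH.
    by rewrite /p4; adj_simpl.
  have [nx|nx] := boolP (adj n x).
    have /andP[+ _] := noP4 h0 t n x h0H tH nH xH.
    by rewrite /p4; adj_simpl.
  apply: noext; exists n, t, y, x; split; first by rewrite /p4; adj_simpl.
  move=> h hH; rewrite !(adj_sym h) (TH t) ?(TH y) //=.
  by rewrite (NH n) ?(NH x).
- rewrite Ny /= negbK => ty; apply/negP => xy.
  have [yH _] := andP Ny; have yh := NH _ _ Ny h0H.
  have /andP[+ _] := noP4 h0 t y x h0H tH yH xH.
  by rewrite /p4; adj_simpl.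
Qed.

(* A connected and co-connected graph will be shown to have this property for
   the module [setT]; its first half excludes that the graph is a minimal polar
   obstruction. *)
Definition outcome H :=
  ((forall U : {set G}, U \proper H -> pol G U) -> pol G H) /\
  (mono G H \/ has_part G).

Definition spider_head K S := [set x | (x \notin K :|: S) &&
  ([forall k in K, adj x k] && [forall s in S, ~~ adj x s])].

Definition spread K S := K :|: S :|: spider_head K S.

Lemma spider_headP K S x : reflect
  [/\ x \notin K, x \notin S, {in K, forall k, adj x k} &
      {in S, forall s, ~~ adj x s}] (x \in spider_head K S).
Proof.
rewrite !inE negb_or; apply: (iffP and3P) => [|[-> -> ? ?]].
  by case=> /andP[? ?] /forall_inP ? /forall_inP ?; split.
by split=> //; apply/forall_inP.
Qed.

Lemma outcome_mono H : mono G H -> outcome H.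
Proof. by move=> mH; split; [move=> _; apply: mono_pol | left]. Qed.

(* A polar partition of the head extends by [K] and [S]. *)
Lemma spread_outcome K S k : k \in K -> multip G K -> clu G S ->
  mono G (spread K S) \/ has_part G -> outcome (spread K S).
Proof.
move=> kK mK cS; split=> // allpol.
have [|A [AR mA cB]] := pol_disjoint (allpol (spider_head K S) _).
  apply/properP; split; first exact: subsetUr.
  by exists k; [rewrite !inE kK | apply/negP => /spider_headP[]; rewrite kK].
exists (K :|: A), (S :|: (spider_head K S :\: A)); split.
- apply/subsetP=> x /setUP[/setUP[]|] xh; rewrite !in_setU ?in_setD xh ?orbT //.
  by rewrite andbT; case: (x \in A); rewrite ?orbT.
- have KA x y : x \in K -> y \in A -> adj x y.
    by move=> xK /(subsetP AR) /spider_headP[_ _ yK _]; rewrite adj_sym yK.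
  move=> x y z /setUP[xK|xA] /setUP[yK|yA] /setUP[zK|zA] xy yz;
  first [by apply: (mK x y z) | by apply: (mA x y z)
   | by rewrite KA in xy | by rewrite adj_sym KA in xy
   | by rewrite KA in yz | by rewrite adj_sym KA in yz].
- have SB x y : x \in S -> y \in spider_head K S :\: A -> ~~ adj x y.
    move=> xS; rewrite in_setD => /andP[_ /spider_headP[_ _ _ yS]].
    by rewrite adj_sym yS.
  have SB' x y : y \in S -> x \in spider_head K S :\: A -> ~~ adj x y.
    by move=> yS xB; rewrite adj_sym SB.
  move=> x y z /setUP[xS|xB] /setUP[yS|yB] /setUP[zS|zB] xy yz;
  first [by apply: (cS x y z) | by apply: (cB x y z)
   | by have := SB _ _ xS yB; rewrite xy | by have := SB' _ _ yS xB; rewrite xy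
   | by have := SB _ _ yS zB; rewrite yz | by have := SB' _ _ zS yB; rewrite yz].
Qed.

Lemma clique_multip K : clique G K -> multip G K.
Proof.
move=> cK x y z xK yK zK.
have [->|xy] := eqVneq x y => //.
by rewrite cK.
Qed.

Lemma stable_clu K : stable G K -> clu G K.
Proof. by move=> sK x y z xK yK _; rewrite (negPf (sK x y xK yK)). Qed.

Lemma mono_cover3 (V A B1 B2 : {set G}) :
  V \subset A :|: (B1 :|: B2) -> stable G A -> clique G B1 -> clique G B2 ->
  {in B1 & B2, forall x y, ~~ adj x y} -> mono G V.
Proof.
move=> sV sA c1 c2 c12; exists A, (B1 :|: B2); split=> //.
have c21 : {in B2 & B1, forall x y, ~~ adj x y}.
  by move=> x y ? ?; rewrite adj_sym c12.
move=> x y z /setUP[x1|x2] /setUP[y1|y2] /setUP[z1|z2] xy yz xz;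
first [by apply: c1 | by apply: c2
   | by have := c12 _ _ x1 y2; rewrite xy | by have := c21 _ _ x2 y1; rewrite xy
   | by have := c12 _ _ y1 z2; rewrite yz | by have := c21 _ _ y2 z1; rewrite yz].
Qed.

(** A split head makes the whole spread split: its stable part joins [S] and its clique joins [K].
    Otherwise the head contains a 2K2, C4 or C5. Joined with both [b] and [c] the first gives a
    part, and for the other two [b] alone is the hub of a wheel. *)
Lemma split_spread_outcome K S b c : clique G K -> stable G S ->
  b \in K -> c \in K -> b != c -> outcome (spread K S).
Proof.
move=> cK sS bK cK' bc; apply: (spread_outcome bK); first exact: clique_multip.
  exact: stable_clu.
have bc' : adj b c by apply: cK.
have hbc s : inside (spider_head K S) s -> all (adj b) s && all (adj c) s.
  move=> sR; apply/andP; split; apply/allP=> x /sR /spider_headP[_ _ xK _];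
  by rewrite adj_sym xK.
have [[A [B [sH sA cB]]]|config] := split_or_config (spider_head K S).
  left; exists (S :|: (A :&: spider_head K S)).
  exists (K :|: (B :&: spider_head K S)); split.
  - apply/subsetP=> x /setUP[/setUP[]|] xh; rewrite !in_setU ?in_setI xh ?orbT //.
    by rewrite !andbT; move/subsetP/(_ x xh): sH; rewrite in_setU => /orP[]->;
      rewrite ?orbT.
  - move=> x y /setUP[xS|/setIP[xA /spider_headP[_ _ _ xS]]]
              /setUP[yS|/setIP[yA /spider_headP[_ _ _ yS]]].
    + exact: sS.
    + by rewrite adj_sym yS.
    + exact: xS.
    + exact: sA.
  - apply: clique_clu => x y /setUP[xK|/setIP[xB /spider_headP[_ _ xK _]]]
              /setUP[yK|/setIP[yB /spider_headP[_ _ yK _]]] xy.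
    + exact: cK.
    + by rewrite adj_sym yK.
    + exact: xK.
    + exact: cB.
right; case: config => [[p [q [r [s [/hbc /= + C]]]]]|[p [q [r [s [/hbc /= + C]]]]]|
  [p [q [r [s [t [/hbc /= + C]]]]]]].
- case/and3P: C => pq rs /and4P[pr ps qr qs].
  case/andP=> /and5P[bp bq br bs _] /and5P[cp cq cr cs _].
  apply: (@has_K2_join_2K2 _ b c p r q s); last by rewrite /=; adj_simpl.
  by rewrite /= !inE; neq_simpl.
- case/andP: C => /and4P[pq qr rs sp] /and4P[pDr qDs pr qs].
  case/andP=> /and5P[bp bq br bs _] _.
  apply: (@has_wheel4 _ b p r q s); last by rewrite /=; adj_simpl.
  by rewrite /= !inE; neq_simpl.
- case/andP: C => /and5P[pq qr rs st tp] /and5P[pr ps qs qt rt].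
  case/andP=> /and5P[bp bq br bs /andP[bt _]] _.
  apply: (@has_wheel5 _ b p r t q s); last by rewrite /=; adj_simpl.
  by rewrite /= !inE; neq_simpl.
Qed.

End Modules.

(** * P4-sparse and P4-extendible graphs *)

Section P4.
Variable G : sgraph.
Implicit Types (a b c d p q r s v w x y : G).

Lemma p4_rev a b c d : p4 a b c d -> p4 d c b a.
Proof.
by case/and5P=> ab bc cd ac /andP[bd ad]; rewrite /p4; adj_simpl.
Qed.

Lemma p4_uniq a b c d : p4 a b c d -> uniq [:: a; b; c; d].
Proof.
case/and5P=> ab bc cd ac /andP[bd ad].
by rewrite /= !inE; neq_simpl.
Qed.

Lemma p4_induces a b c d : p4 a b c d -> induces_P4 [set x in [:: a; b; c; d]].
Proof.
move=> abcd; have us := p4_uniq abcd.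
set s := [:: a; b; c; d] in us *.
have is_ (x : induced [set x in s]) : index (val x) s < 4.
  by have := valP x; rewrite inE -index_mem.
have sI (i : 'I_4) : nth a s i \in [set x in s] by rewrite inE mem_nth.
exists (fun u : induced [set x in s] => Ordinal (is_ u)).
  exists (fun i : 'I_4 => Sub (nth a s i) (sI i)) => [u|i]; apply: val_inj.
    by apply: nth_index; move: (valP u : val u \in [set x in s]); rewrite in_set.
  by change (index (nth a s i) s = i); apply: index_uniq.
move=> [x xs] [y ys] /=; rewrite /path_adj /induced_adj /=.
have [xs' ys'] : x \in s /\ y \in s by move: (xs) (ys); rewrite !inE.
case/and5P: abcd => ab bc cd ac /andP[bd ad]; move: us xs' ys' => /=.
rewrite !inE !negb_or => /and4P[/and3P[ab' ac' ad'] /andP[bc' bd'] cd' _].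
by move=> /or4P[] /eqP-> /or4P[] /eqP->; adj_simpl.
Qed.

(* [x] sees all of the P4 [a - b - c - d], only its midpoints, or nothing. *)
Definition tri a b c d x :=
  [&& adj x a == adj x d, adj x b == adj x c & adj x a ==> adj x b].

Lemma tri_or_p4 a b c d x : p4 a b c d ->
  tri a b c d x \/ exists p q r s,
   [/\ p4 p q r s, x \in [:: p; q; r; s] &
       {subset [:: p; q; r; s] <= [:: x; a; b; c; d]}].
Proof.
move=> /and5P[ab bc cd ac /andP[bd ad]]; rewrite /tri.
pose found p q r s := p4 p q r s && (x \in [:: p; q; r; s]) &&
  all (mem [:: x; a; b; c; d]) [:: p; q; r; s].
(* Up to reversal of the P4 there are four kinds of second P4 through [x]; together with [tri] they
   exhaust the sixteen adjacency patterns of [x]. *)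
suff: [|| [&& adj x a == adj x d, adj x b == adj x c & adj x a ==> adj x b],
  found x a b c, found x b c d, found x c b a, found x d c b, found a x c d,
  found d x b a, found a x d c | found d x a b].
  have F p q r s : found p q r s -> exists p q r s,
      [/\ p4 p q r s, x \in [:: p; q; r; s] &
       {subset [:: p; q; r; s] <= [:: x; a; b; c; d]}].
    by case/andP=> /andP[pqrs xs] /allP sub; exists p, q, r, s.
  case/orP=> [|found_some]; [by left | right; move: found_some].
  by do 7![case/orP=> [/F//|]]; move/F.
have [xa|xa] := boolP (adj x a); have [xb|xb] := boolP (adj x b);
have [xc|xc] := boolP (adj x c); have [xd|xd] := boolP (adj x d);
by rewrite /found /p4 /= ?inE ?eqxx ?orbT /=; adj_simpl; rewrite ?orbT.
Qed.

Definition sparse_p4 := forall a b c d p q r s x,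
  p4 a b c d -> p4 p q r s -> x \notin [:: a; b; c; d] ->
  x \in [:: p; q; r; s] ->
  ~ {subset [:: p; q; r; s] <= [:: x; a; b; c; d]}.

Lemma P4_sparse_p4 : P4_sparse G -> sparse_p4.
Proof.
move=> spG a b c d p q r s x abcd pqrs xabcd xpqrs sub.
have us := p4_uniq abcd.
have W : [set x in [:: a; b; c; d]] = [set x in [:: p; q; r; s]].
  apply: (spG [set y in [:: x; a; b; c; d]]); try exact: p4_induces.
  - have/card_uniqP : uniq [:: x; a; b; c; d] by rewrite cons_uniq xabcd.
    by rewrite cardsE.
  - by apply/subsetP=> y; rewrite !in_set (in_cons x) orbC => ->.
  - by apply/subsetP=> y; rewrite !in_set; apply: sub.
by move/setP/(_ x): W; rewrite !in_set xpqrs (negPf xabcd).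
Qed.

Definition meets a b c d x := exists p q r s, [/\ p4 p q r s,
  x \in [:: p; q; r; s] & has (mem [:: a; b; c; d]) [:: p; q; r; s]].

Definition extendible_p4 := forall a b c d x y,
  p4 a b c d -> x \notin [:: a; b; c; d] -> y \notin [:: a; b; c; d] ->
  meets a b c d x -> meets a b c d y -> x = y.

Lemma P4_extendible_p4 : P4_extendible G -> extendible_p4.
Proof.
move=> exG a b c d x y abcd xW yW.
have meet u : meets a b c d u -> in_P4_meeting [set z in [:: a; b; c; d]] u.
  case=> p [q [r [s [pqrs us /hasP[z zpqrs zabcd]]]]].
  exists [set z in [:: p; q; r; s]]; split; first exact: p4_induces.
    by rewrite in_set.
  by apply/set0Pn; exists z; rewrite !in_set; apply/andP.
move=> /meet xm /meet ym.
by apply: (exG _ (p4_induces abcd)) xm ym; rewrite in_set.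
Qed.

Lemma tri_or_meets a b c d x : p4 a b c d -> x \notin [:: a; b; c; d] ->
  tri a b c d x \/ meets a b c d x.
Proof.
move=> abcd xW; have [|[p [q [r [s [pqrs xs sub]]]]]] := tri_or_p4 x abcd.
  by left.
right; exists p, q, r, s; split=> //; apply/hasP; have := p4_uniq pqrs.
(* [p] and [q] are distinct, so they are not both [x]. *)
have pOr : p \in [:: a; b; c; d] \/ q \in [:: a; b; c; d].
  have := sub q; have := sub p; rewrite !(in_cons x) !inE !eqxx ?orbT.
  move=> /(_ isT)/predU1P[px|->]; last by left.
  move=> /(_ isT)/predU1P[qx|->]; last by right.
  by have := p4_uniq pqrs; rewrite px qx /= inE eqxx.
by case: pOr => ?; [exists p | exists q]; rewrite // !inE eqxx ?orbT.
Qed.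

(** [b] and [a] represent [K] and [S]: an outside vertex is complete to both sets, or only to [K]
    (the head), or anticomplete to both. The last two clauses say that the head is complete to the
    first kind and anticomplete to the last. *)
Definition frame (K S : {set G}) a b :=
  [/\ b \in K, a \in S,
   forall x, x \notin K -> x \notin S ->
     [/\ {in K, forall k, adj x k = adj x b}, {in S, forall s, adj x s = adj x a} &
         adj x a -> adj x b],
   forall x t, x \notin K -> x \notin S -> t \notin K -> t \notin S ->
     adj x b -> ~~ adj x a -> adj t b -> adj t a -> adj x t &
   forall x n, x \notin K -> x \notin S -> n \notin K -> n \notin S ->
     adj x b -> ~~ adj x a -> ~~ adj n b -> ~~ adj n a -> ~~ adj x n].

Lemma frame_module K S a b : frame K S a b -> module (spread K S).
Proof.
case=> bK aS cst RT RN x; rewrite !in_setU !negb_or -andbA => /and3P[xK xS xh].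
have [cK cS ab] := cst x xK xS.
have [xb|xb] := boolP (adj x b); last first.
  have xa : ~~ adj x a by apply: contra xb.
  right=> h /setUP[/setUP[]|]; [by move/cK-> | by move/cS-> |].
  case/spider_headP=> hK hS /(_ b bK) hb /(_ a aS) ha.
  by rewrite adj_sym RN.
have xa : adj x a.
  apply: contraNT xh => xa; apply/spider_headP; split=> // [k /cK|s' /cS] -> //.
left=> h /setUP[/setUP[]|]; [by move/cK-> | by move/cS->; apply: xa |].
case/spider_headP=> hK hS /(_ b bK) hb /(_ a aS) ha.
by rewrite adj_sym RT.
Qed.

(** The third condition serves the growth of modules: an earlier module that sees just the midpoints
    of the P4 is swallowed by [H]. *)
Definition locally_decomposed a b c d := exists H : {set G},
  [/\ {subset [:: a; b; c; d] <= H}, module H,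
      forall x, adj x b -> adj x c -> ~~ adj x a -> ~~ adj x d -> x \in H &
      outcome H].

Lemma spread_local (K S : {set G}) a b c d :
  b \in K -> c \in K -> a \in S -> d \in S ->
  module (spread K S) -> outcome (spread K S) -> locally_decomposed a b c d.
Proof.
move=> bK cK aS dS mH oH; exists (spread K S); split=> //.
  by move=> x; rewrite !inE => /or4P[]/eqP->; rewrite ?bK ?cK ?aS ?dS ?orbT.
move=> x xb _ xa _; apply/negPn/negP=> /mH[] xH.
  by rewrite xH ?inE ?aS ?orbT in xa.
by have := xH b; rewrite xb !inE bK => /(_ isT).
Qed.

(* The legs are the edges [x - f x]. *)
Definition thin_spider (K : {set G}) (f : G -> G) :=
  [/\ clique G K, {in K &, forall x y, x != y -> ~~ adj (f x) (f y)} &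
      {in K &, forall x y, adj x (f y) = (x == y)}].

Lemma thin_stable K f : thin_spider K f -> stable G (f @: K).
Proof.
case=> _ sK _ _ _ /imsetP[x xK ->] /imsetP[y yK ->].
by have [->|/sK->//] := eqVneq x y; rewrite adj_irrefl.
Qed.

Lemma thin_p4 K f x y : thin_spider K f -> x \in K -> y \in K -> x != y ->
  p4 (f x) x y (f y).
Proof.
case=> cK sK fK xK yK xy; have xy' := cK x y xK yK xy; have fxy := sK x y xK yK xy.
have [xfx yfy] : adj x (f x) /\ adj y (f y) by rewrite !fK ?eqxx.
have [xfy yfx] : ~~ adj x (f y) /\ ~~ adj y (f x).
  by rewrite !fK // (eq_sym y) xy.
by rewrite /p4; adj_simpl.
Qed.

(** The leg at [b] and any other leg span a P4, for which sparsity makes an outside vertex satisfy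
    [tri]. So all legs are compared with the one at [b]. *)
Lemma thin_frame K f b c : sparse_p4 -> thin_spider K f ->
  b \in K -> c \in K -> b != c -> forall x, x \notin K -> x \notin f @: K ->
  [/\ {in K, forall k, adj x k = adj x b},
      {in f @: K, forall s, adj x s = adj x (f b)} &
      adj x (f b) -> adj x b].
Proof.
move=> spG th bK cK bc x xK xS.
have xbk k : k \in K -> k != b ->
    [/\ adj x k = adj x b, adj x (f k) = adj x (f b) & adj x (f b) -> adj x b].
  move=> kK kb; have bkp4 := thin_p4 th bK kK; rewrite eq_sym in bkp4.
  have xW : x \notin [:: f b; b; k; f k].
    have xf y : y \in K -> (x == f y) = false.
      by move=> yK; apply: contraNF xS => /eqP->; apply: imset_f.
    have xk y : y \in K -> (x == y) = false by move=> yK; apply: contraNF xK => /eqP->.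
    by rewrite !inE !xf ?xk.
  have [/and3P[/eqP-> /eqP-> /implyP?]|] := tri_or_p4 x (bkp4 kb);
    first by split.
  case=> p [q [r [s [pqrs xs sub]]]].
  by case: (spG _ _ _ _ _ _ _ _ _ (bkp4 kb) pqrs xW xs sub).
have [_ _ fbb] := xbk c cK (contra_neq (@esym _ _ _) bc).
split=> // [k kK|_ /imsetP[k kK ->]]; have [->//|kb] := eqVneq k b;
by case: (xbk k kK kb).
Qed.

End P4.

Lemma p4_compl (G : sgraph) (a b c d : G) :
  p4 a b c d -> @p4 (compl G) b d a c.
Proof.
move=> abcd; have := p4_uniq abcd; case/and5P: abcd => ab bc cd ac /andP[bd ad].
rewrite /= !inE !negb_or => /and4P[/and3P[ab' ac' ad'] /andP[bc' bd'] cd' _].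
by rewrite /p4 !compl_adjE; adj_simpl.
Qed.

Lemma p4_of_compl (G : sgraph) (p q r s : G) :
  @p4 (compl G) p q r s -> p4 q s p r.
Proof.
move=> pqrs; have : uniq ([:: p; q; r; s] : seq G) := p4_uniq pqrs.
rewrite /= !inE !negb_or => /and4P[/and3P[pq pr ps] /andP[qr qs] rs _].
move: pqrs; rewrite /p4 !compl_adjE; adj_simpl; rewrite /= !negbK.
by case/and5P=> npq nqr nrs apr /andP[aqs aps]; adj_simpl.
Qed.

Lemma sparse_compl (G : sgraph) : sparse_p4 G -> sparse_p4 (compl G).
Proof.
move=> spG a b c d p q r s x /p4_of_compl abcd /p4_of_compl pqrs xW xs sub.
apply: (spG _ _ _ _ _ _ _ _ x abcd pqrs).
- by move: xW; rewrite !inE !negb_or => /and4P[-> -> -> ->].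
- by move: xs; rewrite !inE => /or4P[]->; rewrite ?orbT.
- move=> y ys; have : y \in [:: x; a; b; c; d].
    by apply: sub; move: ys; rewrite !inE => /or4P[]->; rewrite ?orbT.
  by rewrite !inE => /predU1P[->|/or4P[]->]; rewrite ?eqxx ?orbT.
Qed.

(** Complementation exchanges the roles of [K] and [S] and keeps the head. *)
Lemma spread_compl (G : sgraph) (K S : {set G}) :
  module (spread (G := compl G) S K) -> module (spread K S).
Proof.
have headE : spider_head (G := compl G) S K = spider_head K S.
  apply/setP=> x; apply/idP/idP.
    case/(@spider_headP (compl G) S K x) => xS xK hS hK.
    apply/(@spider_headP G K S x); split=> // [k kK|s /hS]; last first.
      by rewrite compl_adjE => /andP[].
    have := hK k kK; rewrite compl_adjE negb_and !negbK => /orP[/eqP xk|//].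
    by rewrite xk kK in xK.
  case/(@spider_headP G K S x) => xK xS hK hS; apply/(@spider_headP (compl G) S K x).
  split=> // [s sS|k kK]; last by rewrite compl_adjE hK // andbF.
  by rewrite compl_adjE hS // andbT; apply: contraNneq xS => ->.
rewrite /spread headE (setUC S) => mH x xH; have [h|h] := mH x xH.
  by right=> y /h; rewrite compl_adjE => /andP[].
left=> y yH; have := h y yH; rewrite compl_adjE negb_and negbK => /orP[/eqP E|].
  by rewrite E yH in xH.
by rewrite negbK.
Qed.

Lemma subn_card_lt (T : finType) (A B : {set T}) n :
  #|A| < #|B| -> #|T| - #|A| < n.+1 -> #|T| - #|B| < n.
Proof.
move=> AB; have BT : #|A| < #|T| by apply: leq_trans AB (max_card _).
rewrite ltnS; apply: leq_trans; exact: ltn_sub2l.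
Qed.

(* Enlarge a thin spider, in the graph or in its complement, as long as
   possible: an edge from the head to an outside vertex seeing nothing of the
   spider is a new leg; a non-edge from the head to a vertex seeing everything
   is impossible with three legs, and with two legs it turns the complement
   into a thin spider with three legs. *)
Lemma sparse_spread (G : sgraph) (K : {set G}) f (a b c d : G) :
  sparse_p4 G -> p4 a b c d -> thin_spider K f -> b \in K -> c \in K ->
  f b = a -> f c = d ->
  exists K' S' : {set G}, [/\ clique G K', stable G S', b \in K' /\ c \in K',
    a \in S' /\ d \in S' & module (spread K' S')].
Proof.
have [n] := ubnP (#|G| - #|K|).
elim: n G K f a b c d => // n IHn G K f a b c d Kn spG abcd th bK cK' fb fc.
have [ab bD cd ac /andP[bd ad]] := and5P abcd.
have bc : b != c by apply: adj_neq.
have stS := thin_stable th; have [cK sK fK] := th.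
have cst := thin_frame spG th bK cK' bc; rewrite fb in cst.
have aS : a \in f @: K by rewrite -fb imset_f.
have dS : d \in f @: K by rewrite -fc imset_f.
have [[r [m [rK rS mK [mS rb ra mb [ma rm]]]]]|noRN] := classic (exists r m,
  [/\ r \notin K, r \notin f @: K, m \notin K & [/\ m \notin f @: K, adj r b,
      ~~ adj r a, ~~ adj m b & ~~ adj m a /\ adj r m]]).
  have [rKE rSE _] := cst r rK rS; have [mKE mSE _] := cst m mK mS.
  have kr k : k \in K -> (k == r) = false by move=> kK; apply: contraNF rK => /eqP<-.
  apply: (IHn G (r |: K) (fun x => if x == r then m else f x)) abcd _ _ _ _ _ => //.
  - by apply: subn_card_lt Kn; rewrite cardsU1 rK.
  - split.
    + by apply: cliqueU1 => // k /rKE->.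
    + move=> x y /setU1P[->|xK] /setU1P[->|yK]; rewrite ?eqxx ?kr // => xy.
      * by rewrite mSE ?imset_f.
      * by rewrite adj_sym mSE ?imset_f.
      * exact: sK.
    + move=> x y /setU1P[->|xK] /setU1P[->|yK]; rewrite ?eqxx ?kr //.
      * by rewrite rSE ?imset_f // (negPf ra) eq_sym kr.
      * by rewrite adj_sym mKE // (negPf mb).
      * exact: fK.
  - by rewrite inE bK orbT.
  - by rewrite inE cK' orbT.
  - by rewrite kr.
  - by rewrite kr.
have [[r [t [rK rS tK [tS rb ra tb [ta rt]]]]]|noRT] := classic (exists r t,
  [/\ r \notin K, r \notin f @: K, t \notin K & [/\ t \notin f @: K, adj r b,
      ~~ adj r a, adj t b & adj t a /\ ~~ adj r t]]); last first.
  exists K, (f @: K); split=> //; apply: (@frame_module _ _ _ a b); split=> //.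
  - move=> x t xK xS tK tS xb xa tb ta; apply/negPn/negP=> xt; apply: noRT.
    by exists x, t.
  - move=> x m xK xS mK mS xb xa mb ma; apply/negP=> xm; apply: noRN.
    by exists x, m.
have [rKE rSE _] := cst r rK rS; have [tKE tSE _] := cst t tK tS.
have [rc rd] : adj r c /\ ~~ adj r d by split; [rewrite rKE | rewrite rSE].
have [tc td] : adj t c /\ adj t d by split; [rewrite tKE | rewrite tSE].
have [k3 /andP[k3K /andP[k3b k3c]]|K2] :=
  pickP [pred k | [&& k \in K, k != b & k != c]].
  have fk3 : f k3 \in f @: K by apply: imset_f.
  have tf : adj t (f k3) by rewrite tSE.
  have rf : ~~ adj r (f k3) by rewrite rSE.
  have bf : ~~ adj b (f k3) by rewrite fK // eq_sym.
  have kf : adj k3 (f k3) by rewrite fK.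
  have kd : ~~ adj k3 d by rewrite -fc fK.
  (* These P4s differ only in their last vertex, so together they span five vertices, against
     sparsity. *)
  have P1 : p4 r b t d by rewrite /p4; adj_simpl.
  have P2 : p4 r b t (f k3) by rewrite /p4; adj_simpl.
  case: (spG _ _ _ _ _ _ _ _ (f k3) P1 P2).
  - by rewrite !inE; neq_simpl.
  - by rewrite !inE eqxx !orbT.
  - by move=> y; rewrite !inE => /or4P[]->; rewrite ?orbT.
have abcd' : @p4 (compl G) b d a c by apply: p4_compl.
have [da [dr ar]] : d != a /\ d != r /\ a != r by split; [|split]; neq_simpl.
have [bt ct] : b != t /\ c != t by split; neq_simpl.
(* In the complement d, a, r form a triangle, with legs d - b, a - c and r - t. Since [K] is just b
   and c by now, the new spider has a larger body and the induction applies to it. *)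
pose g (x : compl G) : compl G := if x == d then b else if x == a then c else t.
have [gd [ga gr]] : g d = b /\ g a = c /\ g r = t.
  by rewrite /g; adj_simpl.
have dab : ~~ adj d a by rewrite adj_sym.
have [K' [S' [clK' stS' [dK' aK'] [bS' cS'] mKS]]] :
    exists K' S' : {set compl G}, [/\ clique (compl G) K', stable (compl G) S',
      d \in K' /\ a \in K', b \in S' /\ c \in S' &
      module (spread (G := compl G) K' S')].
  apply: (IHn (compl G) [set d; a; r] g) => //; try by rewrite !inE eqxx ?orbT.
  - apply: subn_card_lt Kn; apply: (@leq_ltn_trans #|[set b; c]|).
      apply/subset_leq_card/subsetP=> x xK; rewrite !inE.
      by have := K2 x; rewrite /= xK /= => /negbT; rewrite negb_and !negbK.
    by rewrite cards2 bc (setUC _ [set r]) cardsU1 cards2 !inE; adj_simpl.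
  - exact: sparse_compl.
  - split.
    + move=> x y; rewrite !inE -!orbA => /or3P[]/eqP-> /or3P[]/eqP->;
        by rewrite compl_adjE; adj_simpl.
    + by move=> x y; rewrite !inE -!orbA => /or3P[]/eqP-> /or3P[]/eqP->;
        rewrite ?gd ?ga ?gr compl_adjE; adj_simpl.
    + by move=> x y; rewrite !inE -!orbA => /or3P[]/eqP-> /or3P[]/eqP->;
        rewrite ?gd ?ga ?gr compl_adjE; neq_simpl.
exists S', K'; split=> //.
- by move=> x y xS yS xy; have := stS' x y xS yS; rewrite compl_adjE xy negbK.
- move=> x y xK yK; have [->|xy] := eqVneq x y; first by rewrite adj_irrefl.
  by have := clK' x y xK yK xy; rewrite compl_adjE => /andP[].
- exact: spread_compl.
Qed.

Ltac split_members := rewrite !inE; repeat match goal with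
  | |- is_true (_ || _) -> _ => case/orP
  | |- is_true (_ == _) -> _ => move/eqP=> ->
  end.
Ltac small_subset :=
  let x := fresh in apply/subsetP=> x; split_members; by rewrite ?eqxx ?orbT.
Ltac small_pairs :=
  let x := fresh in let y := fresh in move=> x y; split_members; by adj_simpl.
Ltac small_triples := let x := fresh in let y := fresh in let z := fresh in
  move=> x y z; split_members; by adj_simpl.

Ltac adj_bools x a b c d v := rewrite /tri; case: (adj x a); case: (adj x b);
  case: (adj x c); case: (adj x d); case: (adj x v); by [].
Ltac by_second second x a b c d v :=
  move: second; rewrite /= !inE ?eqxx ?orbT; adj_simpl;
  move=> /(_ isT); adj_bools x a b c d v.

(** * Modules around a single P4 *)

Section Local.
Variable G : sgraph.
Implicit Types (a b c d k p q r s v w x y : G) (K S V : {set G}).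

Lemma sparse_local a b c d :
  sparse_p4 G -> p4 a b c d -> locally_decomposed a b c d.
Proof.
move=> spG abcd; have [ab bc cd ac /andP[bd ad]] := and5P abcd.
have bc' := adj_neq bc; have [ad' [ac' bd']] : a != d /\ a != c /\ b != d.
  by do !split; neq_simpl.
pose f x := if x == b then a else d.
have [fb fc] : f b = a /\ f c = d by rewrite /f; adj_simpl.
have th : thin_spider [set b; c] f.
  split.
  - by move=> x y; rewrite !inE => /orP[]/eqP-> /orP[]/eqP->; adj_simpl.
  - by move=> x y; rewrite !inE => /orP[]/eqP-> /orP[]/eqP->; rewrite ?fb ?fc; adj_simpl.
  - by move=> x y; rewrite !inE => /orP[]/eqP-> /orP[]/eqP->; rewrite ?fb ?fc; adj_simpl.
have [||K [S [clK stS [bK cK] [aS dS] mKS]]] := sparse_spread spG abcd th _ _ fb fc.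
- by rewrite !inE eqxx.
- by rewrite !inE eqxx orbT.
by apply: (spread_local bK cK aS dS) => //; apply: split_spread_outcome bc'.
Qed.

Lemma clique_or_nonadjacent V : clique G V \/
  exists x y, [/\ x \in V, y \in V, x != y & ~~ adj x y].
Proof.
have [/exists_inP[x xV /exists_inP[y yV /andP[xy nxy]]]|/exists_inPn nV] :=
  boolP [exists x in V, [exists y in V, (x != y) && ~~ adj x y]].
  by right; exists x, y.
left=> x y xV yV xy; have /exists_inPn/(_ y yV) := nV x xV.
by rewrite xy negbK.
Qed.

Hypothesis exG : extendible_p4 G.

Lemma ext_tri p q r s w x : p4 p q r s -> w \notin [:: p; q; r; s] ->
  meets p q r s w -> x \notin [:: p; q; r; s] -> x != w -> tri p q r s x.
Proof.
move=> pqrs wW mw xW xw; have [//|mx] := tri_or_meets pqrs xW.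
by rewrite (exG pqrs xW wW mx mw) eqxx in xw.
Qed.

(** A violation of one of the last two clauses of [frame] would give a P4 x - c - t - a or n - x - b
    - a with two outside vertices that both meet the given P4; extendibility identifies them, yet
    they see [K] or [S] differently. *)
Lemma ext_frame K S a b c d : p4 a b c d ->
  b \in K -> c \in K -> a \in S -> d \in S ->
  (forall x, x \notin K -> x \notin S -> [/\ tri a b c d x,
    {in K, forall k, adj x k = adj x b} & {in S, forall s, adj x s = adj x a}]) ->
  frame K S a b.
Proof.
move=> abcd bK cK aS dS cst; have [ab bc cd ac /andP[bd ad]] := and5P abcd.
have outW x : x \notin K -> x \notin S -> x \notin [:: a; b; c; d].
  move=> xK xS; rewrite !inE; apply/negP=> /or4P[]/eqP E;
  by rewrite -?E ?aS ?bK ?cK ?dS ?E ?aS ?bK ?cK ?dS in xK xS.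
split=> //.
- by move=> x xK xS; have [/and3P[_ _ /implyP]] := cst x xK xS.
- move=> x t xK xS tK tS xb xa tb ta; apply/negPn/negP=> xt.
  have [_ xKE _] := cst x xK xS; have [_ tKE _] := cst t tK tS.
  have xc : adj x c by rewrite xKE.
  have tc : adj t c by rewrite tKE.
  have P : p4 x c t a by rewrite /p4; adj_simpl.
  have E : x = t.
    apply: (exG abcd); try exact: outW; exists x, c, t, a;
    by rewrite /= !inE !eqxx !orbT.
  by rewrite E ta in xa.
- move=> x n xK xS nK nS xb xa nb na; apply/negP=> xn.
  have P : p4 n x b a by rewrite /p4; adj_simpl.
  have E : x = n.
    apply: (exG abcd); try exact: outW; exists n, x, b, a;
    by rewrite /= !inE !eqxx !orbT.
  by rewrite E (negPf nb) in xb.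
Qed.

Lemma head_empty K S a b : a \in S -> b \in K ->
  (forall x, x \notin K -> x \notin S -> adj x b -> adj x a) ->
  spread K S = K :|: S.
Proof.
move=> aS bK ba; rewrite /spread; suff -> : spider_head K S = set0 by rewrite setU0.
apply/setP=> x; rewrite in_set0; apply/negbTE/negP.
by case/spider_headP=> xK xS /(_ b bK) xb /(_ a aS); rewrite ba.
Qed.

Lemma ext_local_all_tri a b c d : p4 a b c d ->
  (forall x, x \notin [:: a; b; c; d] -> tri a b c d x) ->
  locally_decomposed a b c d.
Proof.
move=> abcd trix; have [ab bc cd ac /andP[bd ad]] := and5P abcd.
have [bK cK aS dS] : [/\ b \in [set b; c], c \in [set b; c],
  a \in [set a; d] & d \in [set a; d]] by rewrite !inE !eqxx ?orbT.
apply: (spread_local bK cK aS dS).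
  apply: (@frame_module _ _ _ a b); apply: (ext_frame abcd) => //.
  move=> x xK xS; have /trix : x \notin [:: a; b; c; d].
    by move: xK xS; rewrite !inE !negb_or => /andP[-> ->] /andP[-> ->].
  move=> /[dup] tr /and3P[/eqP ad' /eqP bc' _]; split=> // y; rewrite !inE;
  by case/orP=> /eqP->.
apply: split_spread_outcome bK cK _; last exact: adj_neq.
- by move=> x y; rewrite !inE => /orP[]/eqP-> /orP[]/eqP->; adj_simpl.
- by move=> x y; rewrite !inE => /orP[]/eqP-> /orP[]/eqP->; adj_simpl.
Qed.

(** Each of the two P4s uses up its only permitted extension on the vertex it lacks, [v] for the
    first and [w] for the second. Every other vertex is therefore regular for both. *)
Lemma ext_tri2 a b c d v p q r s w x : p4 a b c d -> p4 p q r s ->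
  v \notin [:: a; b; c; d] -> v \in [:: p; q; r; s] ->
  {subset [:: p; q; r; s] <= [:: v; a; b; c; d]} ->
  w \in [:: a; b; c; d] -> w \notin [:: p; q; r; s] ->
  x \notin [:: a; b; c; d] -> x != v -> tri a b c d x /\ tri p q r s x.
Proof.
move=> abcd pqrs vW vp sub wW wp xW xv.
have [z zp zW] : exists2 z, z \in [:: p; q; r; s] & z \in [:: a; b; c; d].
  have := sub q; have := sub p; rewrite !(in_cons v) !inE !eqxx ?orbT.
  move=> /(_ isT)/predU1P[pv|pW]; last by exists p; rewrite !inE ?eqxx.
  move=> /(_ isT)/predU1P[qv|qW]; last by exists q; rewrite !inE ?eqxx ?orbT.
  by have := p4_uniq pqrs; rewrite pv qv /= inE eqxx.
have vm : meets a b c d v by exists p, q, r, s; split=> //; apply/hasP; exists z.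
have wm : meets p q r s w by exists a, b, c, d; split=> //; apply/hasP; exists z.
split; first exact: (ext_tri abcd vW vm xW xv).
apply: (ext_tri pqrs wp wm) => //; last by apply: contraNneq xW => ->.
by apply/negP=> /sub; rewrite in_cons (negPf xv) (negPf xW).
Qed.

(** The case where outside vertices treat [v] like an end of the P4; in [ext_module_K] they treat it
    like a midpoint. *)
Lemma ext_module_S a b c d v :
  let K := [set b; c] in let S := [set a; d; v] in
  p4 a b c d -> v \notin [:: a; b; c; d] ->
  (forall x, x \notin [:: a; b; c; d] -> x != v ->
     tri a b c d x /\ adj x v = adj x a) ->
  outcome (spread K S) -> locally_decomposed a b c d.
Proof.
move=> K S abcd vW cst.
have [bK cK aS dS] : [/\ b \in K, c \in K, a \in S & d \in S].
  by rewrite !inE !eqxx ?orbT.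
apply: (spread_local bK cK aS dS); apply: (@frame_module _ _ _ a b).
apply: (ext_frame abcd) => // x xK xS.
have [xW xv] : x \notin [:: a; b; c; d] /\ x != v.
  by move: xK xS; rewrite !inE !negb_or -andbA => /andP[-> ->] /and3P[-> -> ->].
have [tr xva] := cst x xW xv; have [/eqP xad /eqP xbc _] := and3P tr.
split=> // y; rewrite !inE; first by case/orP=> /eqP->.
by case/orP=> [/orP[]|]/eqP->.
Qed.

Lemma ext_module_K a b c d v :
  let K := [set b; c; v] in let S := [set a; d] in
  p4 a b c d -> v \notin [:: a; b; c; d] ->
  (forall x, x \notin [:: a; b; c; d] -> x != v ->
     tri a b c d x /\ adj x v = adj x b) ->
  outcome (spread K S) -> locally_decomposed a b c d.
Proof.
move=> K S abcd vW cst.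
have [bK cK aS dS] : [/\ b \in K, c \in K, a \in S & d \in S].
  by rewrite !inE !eqxx ?orbT.
apply: (spread_local bK cK aS dS); apply: (@frame_module _ _ _ a b).
apply: (ext_frame abcd) => // x xK xS.
have [xW xv] : x \notin [:: a; b; c; d] /\ x != v.
  by move: xK xS; rewrite !inE !negb_or -andbA => /and3P[-> -> ->] /andP[-> ->].
have [tr xvb] := cst x xW xv; have [/eqP xad /eqP xbc _] := and3P tr.
split=> // y; rewrite !inE; last by case/orP=> /eqP->.
by case/orP=> [/orP[]|]/eqP->.
Qed.

Lemma locally_decomposed_rev a b c d :
  locally_decomposed d c b a -> locally_decomposed a b c d.
Proof.
case=> H [sH mH pH oH]; exists H; split=> //.
  by move=> x xW; apply: sH; move: xW; rewrite !inE => /or4P[]->; rewrite ?orbT.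
by move=> x ? ? ? ?; apply: pH.
Qed.

(* The seven ways, up to reversal, in which a vertex [v] creates a second P4
   together with [a - b - c - d]. *)
Lemma ext_local_case a b c d v : p4 a b c d -> v \notin [:: a; b; c; d] ->
  [|| adj v a && ~~ adj v c,
      [&& ~~ adj v a, adj v b, ~~ adj v c & ~~ adj v d] |
      [&& adj v a, adj v c & ~~ adj v d]] ->
  locally_decomposed a b c d.
Proof.
move=> abcd vW; have [ab bc cd ac /andP[bd ad]] := and5P abcd.
have := p4_uniq abcd; rewrite /= !inE !negb_or => /and4P[
  /and3P[ab' ac' ad'] /andP[bc' bd'] cd' _].
have := vW; rewrite !inE !negb_or => /and4P[va' vb' vc' vd'].
have K2 : clique G [set b; c] by small_pairs.
have second p q r s w : p4 p q r s -> w \in [:: a; b; c; d] ->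
    forall x, x \notin [:: a; b; c; d] -> x != v ->
    [&& v \in [:: p; q; r; s], w \notin [:: p; q; r; s] &
        all (mem [:: v; a; b; c; d]) [:: p; q; r; s]] ->
    tri a b c d x && tri p q r s x.
  move=> pqrs wW x xW xv /and3P[vp wp /allP sub]; apply/andP.
  exact: ext_tri2 abcd pqrs vW vp sub wW wp xW xv.
have [aW bW cW dW] : [/\ a \in [:: a; b; c; d], b \in [:: a; b; c; d],
    c \in [:: a; b; c; d] & d \in [:: a; b; c; d]].
  by rewrite !inE !eqxx ?orbT.
have [bK cK aS vS] : [/\ b \in [set b; c], c \in [set b; c],
    a \in [set a; d; v] & v \in [set a; d; v]].
  by rewrite !inE !eqxx ?orbT.
have moduleS : (forall x, x \notin [:: a; b; c; d] -> x != v ->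
    [/\ tri a b c d x, adj x v = adj x a & adj x b -> adj x a]) ->
    mono G [set x in [:: a; b; c; d; v]] -> locally_decomposed a b c d.
  move=> cst mH; apply: (ext_module_S abcd vW) => [x xW xv|].
    by have [] := cst x xW xv.
  apply: outcome_mono; rewrite (head_empty aS bK) => [|x xK xS]; last first.
    have [||//] := cst x.
      by move: xK xS; rewrite !inE !negb_or -andbA => /andP[-> ->] /and3P[-> -> _].
    by move: xS; rewrite !inE !negb_or => /andP[].
  apply: covered_sub mH; apply/subsetP=> x; rewrite !inE -!orbA.
  by case/or3P=> [->|->|/or3P[]->]; rewrite ?orbT.
(* In the first case the five vertices induce a house, a P4 with [v] as true twin of [a], a C5 or a
   P5. House, C5 and P5 admit no head, so [moduleS] applies. In the second case [v] is a false twin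
   of [a]; in the third [v] acts as a copy of [b], adjacent to it or not. *)
case/or3P=> [/andP[va vc]|/and4P[va vb vc vd]|/and3P[va vc vd]].
- have [vb|vb] := boolP (adj v b); have [vd|vd] := boolP (adj v d).
  + have P : p4 a v d c by rewrite /p4; adj_simpl.
    apply: moduleS => [x xW xv|];
      first by by_second (second _ _ _ _ _ P bW x xW xv) x a b c d v.
    by apply: (@mono_cover3 _ _ [set b; d] [set a; v] [set c]);
      [small_subset | small_pairs..].
  + have P : p4 v b c d by rewrite /p4; adj_simpl.
    apply: (ext_module_S abcd vW) => [x xW xv|].
      by by_second (second _ _ _ _ _ P aW x xW xv) x a b c d v.
    have hP := @spider_headP G [set b; c] [set a; d; v].
    apply: (spread_outcome bK); first exact: clique_multip.
      by small_triples.
    have [cR|[x [y [/hP[_ _ xK xS] /hP[_ _ yK yS] xy nxy]]]] :=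
      clique_or_nonadjacent (spider_head [set b; c] [set a; d; v]).
      left; apply: (@mono_cover3 _ _ [set b; d] [set a; v]
        (c |: spider_head [set b; c] [set a; d; v])).
      * apply/subsetP=> x /setUP[/setUP[]|xh]; last by rewrite !in_setU xh !orbT.
          by split_members; rewrite ?eqxx ?orbT.
        by split_members; rewrite ?eqxx ?orbT.
      * by small_pairs.
      * by small_pairs.
      * by apply: cliqueU1 => // x /hP[_ _ xK _]; rewrite adj_sym xK.
      * move=> x y; rewrite !in_set2 => xav /setU1P[->|/hP[_ _ _ yS]].
          by move: xav; case/orP=> /eqP->; adj_simpl.
        by rewrite adj_sym yS // !inE; case/orP: xav => ->; rewrite ?orbT.
    have [xb xc yb yc] := And4 (xK b bK) (xK c cK) (yK b bK) (yK c cK).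
    have [xa xv ya yv] := And4 (xS a aS) (xS v vS) (yS a aS) (yS v vS).
    (* [b] sees the P3 x - c - y, whose ends lie in the head, and the edge av. *)
    right; apply: (@has_K1_join_P3_K2 _ b x c y a v); last by rewrite /=; adj_simpl.
    by rewrite /= !inE; neq_simpl.
  + have P : p4 v a b c by rewrite /p4; adj_simpl.
    apply: moduleS => [x xW xv|];
      first by by_second (second _ _ _ _ _ P dW x xW xv) x a b c d v.
    by apply: (@mono_cover3 _ _ [set v; b] [set a] [set c; d]);
      [small_subset | small_pairs..].
  + have P : p4 v a b c by rewrite /p4; adj_simpl.
    apply: moduleS => [x xW xv|];
      first by by_second (second _ _ _ _ _ P dW x xW xv) x a b c d v.
    by apply: (@mono_cover3 _ _ [set v; b; d] [set a] [set c]);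
      [small_subset | small_pairs..].
- have P : p4 v b c d by rewrite /p4; adj_simpl.
  apply: (ext_module_S abcd vW) => [x xW xv|].
    by by_second (second _ _ _ _ _ P aW x xW xv) x a b c d v.
  by apply: (@split_spread_outcome _ _ _ b c) => //; small_pairs.
- have P : p4 a v c d by rewrite /p4; adj_simpl.
  have moduleK : outcome (spread [set b; c; v] [set a; d]) ->
      locally_decomposed a b c d.
    apply: (ext_module_K abcd vW) => x xW xv.
    by by_second (second _ _ _ _ _ P bW x xW xv) x a b c d v.
  apply: moduleK; set K := [set b; c; v].
  have [bK' cK' vK'] : [/\ b \in K, c \in K & v \in K].
    by rewrite !inE !eqxx ?orbT.
  have [vb|vb] := boolP (adj v b).
  + by apply: (@split_spread_outcome _ _ _ b c) => //; small_pairs.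
  + have hP := @spider_headP G K [set a; d].
    apply: (spread_outcome bK'); first by small_triples.
      by small_triples.
    have [cR|[x [y [/hP[_ _ xK _] /hP[_ _ yK _] xy nxy]]]] :=
      clique_or_nonadjacent (spider_head K [set a; d]).
      left; apply: (@mono_cover3 _ _ [set b; d; v] [set a]
        (c |: spider_head K [set a; d])).
      * apply/subsetP=> x /setUP[/setUP[]|xh]; last by rewrite !in_setU xh !orbT.
          by split_members; rewrite ?eqxx ?orbT.
        by split_members; rewrite ?eqxx ?orbT.
      * by small_pairs.
      * by small_pairs.
      * by apply: cliqueU1 => // x /hP[_ _ xK _]; rewrite adj_sym xK.
      * move=> x y /set1P-> /setU1P[->|/hP[_ _ _ yS]]; first by adj_simpl.
        by rewrite adj_sym yS // !inE eqxx.
    have [xb xc xv] := And3 (xK b bK') (xK c cK') (xK v vK').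
    have [yb yc yv] := And3 (yK b bK') (yK c cK') (yK v vK').
    (* The hub [c] sees the C4 formed by the non-edge bv of the core and a non-edge of the head. *)
    right; apply: (@has_wheel4 _ c b v x y); last by rewrite /=; adj_simpl.
    by rewrite /= !inE; neq_simpl.
Qed.

Lemma ext_local a b c d : p4 a b c d -> locally_decomposed a b c d.
Proof.
move=> abcd.
have [trix|] := classic (forall x, x \notin [:: a; b; c; d] -> tri a b c d x).
  exact: ext_local_all_tri.
move=> /not_all_ex_not[v nh]; have [vW /negP ntv] := imply_to_and _ _ nh.
have vW' : v \notin [:: d; c; b; a].
  by move: vW; rewrite !inE !negb_or => /and4P[-> -> -> ->].
have := @ext_local_case a b c d v abcd vW.
have := @ext_local_case d c b a v (p4_rev abcd) vW'.
move: ntv; rewrite /tri; case: (adj v a); case: (adj v b); case: (adj v c);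
  case: (adj v d) => //= _ L1 L2; by [apply: L2 | apply/locally_decomposed_rev/L1].
Qed.

End Local.

(** * Connected graphs with connected complement *)

Definition few_P4 (G : sgraph) := P4_extendible G \/ P4_sparse G.

Lemma few_P4_local (G : sgraph) (a b c d : G) :
  few_P4 G -> p4 a b c d -> locally_decomposed a b c d.
Proof.
case=> [/P4_extendible_p4 exG|/P4_sparse_p4 spG] P; first exact: (ext_local exG P).
exact: (sparse_local spG P).
Qed.

(* Replacing the only vertex of a P4 that lies in a module by another vertex
   of the module gives another P4. *)
Lemma module_P4 (G : sgraph) (H : {set G}) (a b c d : G) : few_P4 G ->
  module H -> uniq [:: a; b; c; d] -> {subset [:: a; b; c; d] <= H} ->
  forall h x y z, h \in H -> x \notin H -> y \notin H -> z \notin H ->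
    ~~ p4 h x y z && ~~ p4 x y h z.
Proof.
move=> fewG mH us sH h x y z hH xH yH zH.
(* Sparsity is contradicted by one replacement vertex, extendibility only by two. *)
have [h1 [h2 [h1H h2H h1h h2h h12]]] : exists h1 h2,
    [/\ h1 \in H, h2 \in H, h1 != h, h2 != h & h1 != h2].
  have [aH bH cH] : [/\ a \in H, b \in H & c \in H].
    by split; apply: sH; rewrite !inE eqxx ?orbT.
  move: us; rewrite /= !inE !negb_or => /and3P[/and3P[ab ac _] /andP[bc _] _].
  have [ah|ah] := eqVneq a h.
    by exists b, c; rewrite -ah [b == a]eq_sym [c == a]eq_sym.
  have [bh|bh] := eqVneq b h; last by exists a, b.
  by exists a, c; rewrite -bh [c == b]eq_sym.
have same u h' : u \notin H -> h' \in H -> adj u h' = adj u h.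
  by move=> uH h'H; have [mu|mu] := mH u uH; rewrite ?mu // !(negPf (mu _ _)).
have same' u h' : u \notin H -> h' \in H -> adj h' u = adj h u.
  by move=> uH h'H; rewrite adj_sym same // adj_sym.
have out h' u : h' \in H -> u \notin H -> h' != u.
  by move=> h'H; apply: contraNneq => <-.
case: fewG => [/P4_extendible_p4 exG|/P4_sparse_p4 spG];
  apply/andP; split; apply/negP=> P.
- have P' h' : h' \in H -> p4 h' x y z by move=> h'H; rewrite /p4 !(same' _ h').
  have m h' : h' \in H -> meets h x y z h'.
    move=> h'H; exists h', x, y, z; split; first exact: P'.
      by rewrite !inE eqxx.
    by rewrite /= !inE !eqxx !orbT.
  case/eqP: h12; apply: exG P _ _ (m _ h1H) (m _ h2H);
  by rewrite !inE !negb_or ?h1h ?h2h ?andbT /= !out.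
- have P' h' : h' \in H -> p4 x y h' z.
    by move=> h'H; rewrite /p4 !(same _ h') // (same' _ h').
  have m h' : h' \in H -> meets x y h z h'.
    move=> h'H; exists x, y, h', z; split; first exact: P'.
      by rewrite !inE eqxx !orbT.
    by rewrite /= !inE !eqxx.
  case/eqP: h12; apply: exG P _ _ (m _ h1H) (m _ h2H);
  by rewrite !inE !negb_or ?h1h ?h2h ?andbT /= !out.
- have P' : p4 h1 x y z by rewrite /p4 !(same' _ h1).
  apply: (spG _ _ _ _ _ _ _ _ h1 P P').
  + by rewrite !inE !negb_or h1h ?andbT /= !out.
  + by rewrite !inE eqxx.
  + by move=> u; rewrite !inE => /or4P[]->; rewrite ?orbT.
- have P' : p4 x y h1 z by rewrite /p4 !(same _ h1) // (same' _ h1).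
  apply: (spG _ _ _ _ _ _ _ _ h1 P P').
  + by rewrite !inE !negb_or h1h ?andbT /= !out.
  + by rewrite !inE eqxx !orbT.
  + by move=> u; rewrite !inE => /or4P[]->; rewrite ?orbT.
Qed.

(** While the module [H] is not everything, [module_alternative] supplies a P4 whose local module
    contains [H], and also the end [n1], so it is strictly larger. Without any P4, the same
    alternative applied to a single vertex shows that the graph has at most one. *)
Lemma connected_outcome (G : sgraph) : few_P4 G -> ~ disconnected G ->
  ~ disconnected (compl G) -> outcome [set: G].
Proof.
move=> fewG cG ccG.
have [[a [b [c [d abcd]]]]|noP4] := classic (exists a b c d : G, p4 a b c d);
  last first.
  have noP4' (x y z t : G) : ~~ p4 x y z t.
    by apply/negP=> P; apply: noP4; exists x, y, z, t.
  apply: outcome_mono; exists setT, set0; split; first exact: subsetUl.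
    have [x0|G0] := pickP [pred x : G | true]; last by move=> x; have := G0 x.
    move=> _; have m1 : module [set x0].
      move=> x _; have [h|h] := boolP (adj x x0); [left|right];
      by move=> y /set1P->.
    have [|T|//|//|] := @module_alternative _ _ x0 (set11 x0) m1.
    - by move=> *; rewrite !noP4'.
    - move=> x y _ _; have [/set1P-> /set1P->] : x \in [set x0] /\ y \in [set x0].
        by rewrite T !inE.
      by rewrite adj_irrefl.
    - by case=> [n1 [t1 [t2 [n2 [P _]]]]]; rewrite (negPf (noP4' _ _ _ _)) in P.
  by move=> x y z; rewrite inE.
(* Four distinct vertices in [H] allow [module_P4] to exclude P4s that meet [H] in one vertex. *)
have grow n (H : {set G}) : #|G| - #|H| < n -> module H -> outcome H ->
    (exists a b c d : G, uniq [:: a; b; c; d] /\ {subset [:: a; b; c; d] <= H}) ->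
    outcome [set: G].
  elim: n H => // n IHn H Hn mH oH [x [y [z [t [us sH]]]]].
  have xH : x \in H by apply: sH; rewrite inE eqxx.
  have [<-//|//|//|] := module_alternative xH mH (module_P4 fewG mH us sH).
  case=> [n1 [t1 [t2 [n2 [P PH]]]]].
  have [H' [sH' mH' pH' oH']] := few_P4_local fewG P.
  have HH' : H \subset H'.
    by apply/subsetP=> h /PH/and4P[ht1 ht2 hn1 hn2]; apply: pH'.
  apply: (IHn H') => //; last by exists n1, t1, t2, n2; rewrite (p4_uniq P).
  apply: subn_card_lt Hn; apply/proper_card/properP; split=> //.
  exists n1; first by apply: sH'; rewrite inE eqxx.
  apply/negP=> /PH/and4P[_ n1t2 _ _].
  by case/and5P: P => _ _ _ + _; rewrite n1t2.
have [H [sH mH pH oH]] := few_P4_local fewG abcd.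
apply: (grow _ H (ltnSn _)) => //; exists a, b, c, d.
by split=> //; apply: p4_uniq.
Qed.

(** * Monopolarity of disconnected graphs and of joins *)

Section UniversalVertex.
Variables (G : sgraph) (u : G).
Hypothesis uu : forall x, x != u -> adj u x.
Implicit Types (a b c d v x y z : G).

Let Y := [set~ u].

Lemma universal_inside s : inside Y s -> all (adj u) s.
Proof. by move=> sY; apply/allP=> x /sY; rewrite !inE => /uu. Qed.

Lemma universal_P3_K2 x y z c d : x != u -> y != u -> z != u -> c != u -> d != u ->
  adj x y -> adj y z -> ~~ adj x z -> x != z -> adj c d ->
  all (fun t => ~~ adj t c && ~~ adj t d) [:: x; y; z] -> has_part G.
Proof.
move=> /uu ux /uu uy /uu uz /uu uc /uu ud xy yz xz xDz cd /=.
case/and4P=> /andP[xc xd] /andP[yc yd] /andP[zc zd] _.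
apply: (@has_K1_join_P3_K2 _ u x y z c d); last by rewrite /=; adj_simpl.
by rewrite /= !inE; neq_simpl.
Qed.

Lemma not_cluP (V : {set G}) : clu G V \/ exists x y z,
  [/\ x \in V, y \in V, z \in V, adj x y & [/\ adj y z, x != z & ~~ adj x z]].
Proof.
have [|nP] := classic (exists x y z,
  [/\ x \in V, y \in V, z \in V, adj x y & [/\ adj y z, x != z & ~~ adj x z]]).
  by right.
left=> x y z xV yV zV xy yz xz; apply/negPn/negP=> nxz; apply: nP.
by exists x, y, z.
Qed.

(* [far] is the set of vertices other than [u] that see neither [c] nor [d], and
   [Z] its non-isolated part: an edge leaving [Z] ends in a neighbour [v] of [c]
   or [d], and without such an edge a P3 and an edge lie on different sides. *)
Lemma universal_2K2 a b c d : inside Y [:: a; b; c; d] -> two_K2 a b c d ->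
  clu G Y \/ has_part G.
Proof.
move=> inY /and4P[ab cd ac /and3P[ad bc bd]].
have [|[x [y [z [xY yY zY xy [yz xDz xz]]]]]] := not_cluP Y; [by left | right].
pose far := [set z in Y | ~~ adj z c && ~~ adj z d].
pose Z := [set z in far | [exists y in far, adj z y]].
have [aY bY cY dY] : [/\ a \in Y, b \in Y, c \in Y & d \in Y].
  by split; apply: inY; rewrite !inE eqxx ?orbT.
have [[v [t [vY vZ tZ vt]]]|closedZ] := classic (exists v t,
  [/\ v \in Y, v \notin Z, t \in Z & adj v t]).
  move: (tZ); rewrite inE => /andP[tfar /exists_inP[s sfar ts]].
  move: (tfar); rewrite inE => /and3P[tY tc td].
  move: (sfar); rewrite inE => /and3P[sY sc sd].
  have vcd : adj v c || adj v d.
    apply: contraR vZ; rewrite negb_or => vfar.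
    have vf : v \in far by rewrite inE vY.
    by rewrite inE vf; apply/exists_inP; exists t.
  have /and5P[ut us uv uc /andP[ud _]] : all (adj u) [:: t; s; v; c; d].
    by apply: universal_inside => w; rewrite !inE => /or4P[|||/orP[]]/eqP->;
      move: tY sY vY cY dY; rewrite !inE.
  (* ts and cd form a 2K2 of which [v] sees a vertex on each side. If [v] sees four, three or two of
     its vertices, the join with [u] is K2 joined to 2K2, or K1 joined to the co-banner or to P5. *)
  have [vs|vs] := boolP (adj v s); have [vc|vc] := boolP (adj v c);
    have [vd|vd] := boolP (adj v d); rewrite ?(negPf vc) ?(negPf vd) // in vcd.
  - apply: (@has_K2_join_2K2 _ u v t c s d); last by rewrite /=; adj_simpl.
    by rewrite /= !inE; neq_simpl.
  - apply: (@has_K1_join_co_banner _ u v d t c s); last by rewrite /=; adj_simpl.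
    by rewrite /= !inE; neq_simpl.
  - apply: (@has_K1_join_co_banner _ u v c t d s); last by rewrite /=; adj_simpl.
    by rewrite /= !inE; neq_simpl.
  - apply: (@has_K1_join_co_banner _ u v s c t d); last by rewrite /=; adj_simpl.
    by rewrite /= !inE; neq_simpl.
  - apply: (@has_K1_join_P5 _ u s t v c d); last by rewrite /=; adj_simpl.
    by rewrite /= !inE; neq_simpl.
  - apply: (@has_K1_join_P5 _ u s t v d c); last by rewrite /=; adj_simpl.
    by rewrite /= !inE; neq_simpl.
have sep v t : v \in Y -> v \notin Z -> t \in Z -> ~~ adj v t.
  by move=> vY vZ tZ; apply/negP=> vt; apply: closedZ; exists v, t.
have sep' v t : v \in Y -> v \notin Z -> t \in Z -> ~~ adj t v.
  by move=> *; rewrite adj_sym sep.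
have YZ v t : v \in Y -> t \in Y -> adj v t -> (v \in Z) = (t \in Z).
  move=> vY tY vt; apply/idP/idP=> h; apply: contraTT vt => h'; first exact: sep'.
  exact: sep.
have [af bf] : a \in far /\ b \in far by rewrite !inE -!in_setC1 aY bY ac ad bc bd.
have aZ : a \in Z by rewrite inE af; apply/exists_inP; exists b.
have bZ : b \in Z by rewrite -(YZ a b).
have cZ : c \notin Z by rewrite !inE cd /= !andbF.
have dZ : d \notin Z by rewrite -(YZ c d).
have neq v : v \in Y -> v != u by rewrite !inE.
have xyZ := YZ x y xY yY xy; have yzZ := YZ y z yY zY yz.
(* A P3 inside [Z] is paired with the edge cd, one outside with ab. *)
have [xZ|xZ] := boolP (x \in Z); [apply: (@universal_P3_K2 x y z c d) | 
  apply: (@universal_P3_K2 x y z a b)]; try exact: neq; rewrite //=.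
- by rewrite !sep' // -?yzZ -?xyZ.
- by rewrite !sep // -?yzZ -?xyZ.
Qed.

(** If the rest is split, [u] joins its clique; if it is a cluster, [u] alone is the stable part. In
    the remaining case a C4 or C5 gives a wheel with hub [u], and a 2K2 is left to
    [universal_2K2]. *)
Lemma universal_mono_or_part : mono G [set: G] \/ has_part G.
Proof.
have uY : u \notin Y by rewrite !inE eqxx.
have YP x : x \in Y -> adj u x by rewrite !inE => /uu.
have setTE : [set: G] = u |: Y by rewrite setUCr.
have [[A [B [sY sA cB]]]|config] := split_or_config Y.
  left; exists (A :&: Y), (u |: (B :&: Y)); split.
  - rewrite setTE setUCA; apply: setUS; apply/subsetP=> x xY.
    by move/subsetP/(_ x xY): sY; rewrite !in_setU !in_setI xY !andbT.
  - exact: stable_sub (subsetIl _ _) sA.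
  - apply: clique_clu; apply: cliqueU1; first exact: clique_sub (subsetIl _ _) cB.
    by move=> x /setIP[_ /YP].
have [cY|] := classic (clu G Y).
  left; exists [set u], Y; split=> //; first by rewrite setTE.
  by move=> x y /set1P-> /set1P->; rewrite adj_irrefl.
move=> ncY; case: config => [[a [b [c [d [inY C]]]]]|[a [b [c [d [inY C]]]]]|
  [a [b [c [d [e [inY C]]]]]]].
- by have [|] := universal_2K2 inY C; [|right].
- have /and5P[ua ub uc ud _] := universal_inside inY; right.
  case/andP: C => /and4P[ab bc cd da] /and4P[aDc bDd ac bd].
  apply: (@has_wheel4 _ u a c b d); last by rewrite /=; adj_simpl.
  by rewrite /= !inE; neq_simpl.
- have /and5P[ua ub uc ud /andP[ue _]] := universal_inside inY; right.
  case/andP: C => /and5P[ab bc cd de ea] /and5P[ac ad bd be ce].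
  apply: (@has_wheel5 _ u a c e b d); last by rewrite /=; adj_simpl.
  by rewrite /= !inE; neq_simpl.
Qed.

End UniversalVertex.

(** * Transfer along embeddings, complements, unions and joins *)

Lemma mono_embedding (H G : sgraph) (f : H -> G) (V : {set G}) :
  embedding f -> mono G V -> mono H (f @^-1: V).
Proof.
move=> [fI fA] [A [B [sV sA cB]]]; exists (f @^-1: A), (f @^-1: B); split.
- by rewrite -preimsetU; apply: preimsetS.
- by move=> x y; rewrite !inE -!fA; apply: sA.
- by move=> x y z; rewrite !inE -!fA -(inj_eq fI); apply: cB.
Qed.

Lemma embedding_val (G : sgraph) (S : {set G}) :
  @embedding (induced S) G val.
Proof. by split; [apply: val_inj | ]. Qed.

Lemma embedding_compl (H G : sgraph) (f : H -> G) :
  embedding f -> @embedding (compl H) (compl G) f.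
Proof.
move=> [fI fA]; split=> // x y.
by rewrite !compl_adjE fA -(inj_eq fI).
Qed.

Lemma minobs_iso (H G : sgraph) : iso G H ->
  minimal_polar_obstruction H -> minimal_polar_obstruction G.
Proof.
case=> f [g fg gf] fA /minobsP[nH mH].
have ef : embedding f by split=> //; apply: can_inj fg.
have eg : embedding g by split=> [|x y]; [apply: can_inj gf | rewrite -fA !gf].
apply/minobsP; split=> [/(pol_embedding eg)|x]; first by rewrite preimsetT.
apply: covered_sub (pol_embedding ef (mH (f x))); apply/subsetP=> y.
by rewrite !inE (inj_eq (can_inj fg)).
Qed.

Lemma minobs_compl (G : sgraph) :
  minimal_polar_obstruction G <-> minimal_polar_obstruction (compl G).
Proof.
rewrite !minobsP; split=> -[nG mG]; split.
- by move/(pol_complE (G := G)).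
- by move=> x; apply/(pol_complE (G := G)); apply: mG.
- by move/(pol_complE (G := G)).
- by move=> x; apply/(pol_complE (G := G)); apply: mG.
Qed.

Lemma mono_of_induced (G : sgraph) (S : {set G}) :
  mono (induced S) [set: induced S] -> mono G S.
Proof.
case=> A [B [/subsetP sT sA cB]]; exists (val @: A), (val @: B); split.
- apply/subsetP=> x xS; move: (sT (Sub x xS)); rewrite !inE.
  by case/(_ isT)/orP=> /imset_f-/(_ _ val); rewrite SubK => ->; rewrite ?orbT.
- by move=> _ _ /imsetP[x xA ->] /imsetP[y yA ->]; apply: (sA x y).
- move=> _ _ _ /imsetP[x xA ->] /imsetP[y yA ->] /imsetP[z zA ->].
  by rewrite (inj_eq val_inj); apply: (cB x y z).
Qed.

Lemma mono_union (G : sgraph) (X Y : {set G}) :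
  {in X & Y, forall x y, ~~ adj x y} -> mono G X -> mono G Y -> mono G (X :|: Y).
Proof.
move=> sep [A [B [sX sA cB]]] [A' [B' [sY sA' cB']]].
have sep' : {in Y & X, forall x y, ~~ adj x y}.
  by move=> x y xY yX; rewrite adj_sym sep.
exists ((A :&: X) :|: (A' :&: Y)), ((B :&: X) :|: (B' :&: Y)); split.
- apply/subsetP=> x /setUP[] xXY; [move/subsetP/(_ x xXY): sX |
    move/subsetP/(_ x xXY): sY]; rewrite !in_setU !in_setI xXY => /orP[]->;
  by rewrite ?orbT.
- move=> x y /setUP[]/setIP[xA xX] /setUP[]/setIP[yA yX];
  by [apply: sA | apply: sep | apply: sep' | apply: sA'].
- move=> x y z /setUP[]/setIP[xA xX] /setUP[]/setIP[yA yX]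
    /setUP[]/setIP[zA zX] xy yz;
  first [ by apply: (cB x y z) | by apply: (cB' x y z)
   | by rewrite (negPf (sep _ _ xX yX)) in xy
   | by rewrite (negPf (sep' _ _ xX yX)) in xy
   | by rewrite (negPf (sep _ _ yX zX)) in yz
   | by rewrite (negPf (sep' _ _ yX zX)) in yz ].
Qed.

Lemma stable_or_adjacent (G : sgraph) (V : {set G}) : stable G V \/
  exists x y, [/\ x \in V, y \in V & adj x y].
Proof.
have [/exists_inP[x xV /exists_inP[y yV xy]]|/exists_inPn nV] :=
  boolP [exists x in V, [exists y in V, adj x y]].
  by right; exists x, y.
by left=> x y xV yV; have /exists_inPn/(_ y yV) := nV x xV.
Qed.

(** [e] and [f] lie in one clique of the cluster while [x] and [y] lie in two, so [x] or [y] is in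
    another clique. *)
Lemma cluster_edge_far (G : sgraph) (V : {set G}) (e f x y : G) :
  clu G V -> e \in V -> f \in V -> x \in V -> y \in V ->
  adj e f -> x != y -> ~~ adj x y ->
  exists2 z, z \in V & ~~ adj e z /\ ~~ adj f z.
Proof.
move=> cV eV fV xV yV ef xy nxy.
have [xe|] := boolP (~~ adj e x && ~~ adj f x); first by exists x => //; apply/andP.
have [ye|] := boolP (~~ adj e y && ~~ adj f y); first by exists y => //; apply/andP.
have toe t : t \in V -> ~~ (~~ adj e t && ~~ adj f t) -> (e == t) || adj e t.
  move=> tV; rewrite negb_and !negbK => /orP[->|ft]; first by rewrite orbT.
  by case: eqVneq => //= et; apply: (cV e f t).
move=> /(toe _ yV)/predU1P[ey|ey] /(toe _ xV)/predU1P[ex|ex].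
- by rewrite -ex -ey eqxx in xy.
- by rewrite -ey adj_sym ex in nxy.
- by rewrite -ex ey in nxy.
- by case/negP: nxy; apply: (cV x e y) => //; rewrite adj_sym.
Qed.

(** A P3 x - y - z in [X] and the non-edge ab form a wheel with hub [y]. *)
Lemma join_P3 (G : sgraph) (X Y : {set G}) (a b : G) :
  {in X & Y, forall x y, adj x y} -> a \in Y -> b \in Y -> a != b -> ~~ adj a b ->
  clu G X \/ has_part G.
Proof.
move=> full aY bY aDb ab.
have [|[x [y [z [xX yX zX xy [yz xDz xz]]]]]] := not_cluP X; [by left | right].
have [xa xb] := conj (full x a xX aY) (full x b xX bY).
have [ya yb] := conj (full y a yX aY) (full y b yX bY).
have [za zb] := conj (full z a zX aY) (full z b zX bY).
apply: (@has_wheel4 _ y x z a b); last by rewrite /=; adj_simpl.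
by rewrite /= !inE; neq_simpl.
Qed.

Lemma codisconnectedE (G : sgraph) : disconnected (compl G) ->
  exists X : {set G}, [/\ X != set0, X != [set: G] &
    forall x y, x \in X -> y \notin X -> adj x y].
Proof.
case=> X [X0 XT sep]; exists X; split=> // x y xX yX; have := sep x y xX yX.
rewrite compl_adjE negb_and !negbK => /orP[/eqP E|//].
by rewrite -E xX in yX.
Qed.

(** A vertex of a side that is a clique would be universal. So, apart from that case, both sides
    contain a non-edge, and [join_P3] turns both into clusters. If one is stable, the sides form the
    partition; otherwise each contains K1 + K2, and the join of two such graphs is the complement of
    2P3. *)
Lemma codisconnected_mono_or_part (G : sgraph) :
  disconnected (compl G) -> mono G [set: G] \/ has_part G.
Proof.
case/codisconnectedE=> X [X0 XT sep].
have full : {in X & ~: X, forall x y, adj x y}.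
  by move=> x y xX; rewrite inE => yX; apply: sep.
have full' : {in ~: X & X, forall x y, adj x y}.
  by move=> x y xX yX; rewrite adj_sym full.
have [[u uu]|nu] := classic (exists u : G, forall x, x != u -> adj u x).
  exact: universal_mono_or_part uu.
have [x1 [x2 [x1X x2X x12 nx12]]] : exists x1 x2 : G,
    [/\ x1 \in X, x2 \in X, x1 != x2 & ~~ adj x1 x2].
  have [cX|//] := clique_or_nonadjacent X; case: nu.
  have /set0Pn[u uX] := X0; exists u => x xu.
  have [xX|xX] := boolP (x \in X); first by apply: cX; rewrite // eq_sym.
  by apply: full; rewrite ?inE.
have [y1 [y2 [y1X y2X y12 ny12]]] : exists y1 y2 : G,
    [/\ y1 \in ~: X, y2 \in ~: X, y1 != y2 & ~~ adj y1 y2].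
  have [cX|//] := clique_or_nonadjacent (~: X); case: nu.
  have /set0Pn[u uX] : ~: X != set0.
    by apply: contra_neq XT => E; rewrite -[X]setCK E setC0.
  exists u => x xu.
  have [xX|xX] := boolP (x \in ~: X); first by apply: cX; rewrite // eq_sym.
  by apply: full' => //; rewrite inE negbK in xX.
have [cX|] := join_P3 full y1X y2X y12 ny12; last by right.
have [cY|] := join_P3 full' x1X x2X x12 nx12; last by right.
have [sX|[e [f [eX fX ef]]]] := stable_or_adjacent X.
  by left; exists X, (~: X); rewrite setUCr.
have [sY|[e' [f' [eX' fX' ef']]]] := stable_or_adjacent (~: X).
  by left; exists (~: X), X; rewrite setUC setUCr.
have [w wX [ew fw]] := cluster_edge_far cX eX fX x1X x2X ef x12 nx12.
have [w' wX' [ew' fw']] := cluster_edge_far cY eX' fX' y1X y2X ef' y12 ny12.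
have [ee' ef'' ew''] := And3 (full e e' eX eX') (full e f' eX fX') (full e w' eX wX').
have [fe' ff' fw''] := And3 (full f e' fX eX') (full f f' fX fX') (full f w' fX wX').
have [we' wf' ww'] := And3 (full w e' wX eX') (full w f' wX fX') (full w w' wX wX').
right; apply: (@has_co_2P3 _ e w f e' w' f'); last by rewrite /=; adj_simpl.
by rewrite /= !inE; neq_simpl.
Qed.

Lemma minimal_mono_or_part (G : sgraph) : few_P4 G ->
  (forall U : {set G}, U \proper [set: G] -> mono G U) ->
  mono G [set: G] \/ has_part G.
Proof.
move=> fewG minG.
have [[X [X0 XT sep]]|cG] := classic (disconnected G).
  left; rewrite -(setUCr X); apply: mono_union.
  - by move=> x y xX; rewrite inE => yX; apply: sep.
  - by apply: minG; rewrite properT.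
  - by apply: minG; rewrite properT -(inj_eq (@setC_inj _)) setCK setCT.
have [ccG|ccG] := classic (disconnected (compl G)).
  exact: codisconnected_mono_or_part.
by have [] := connected_outcome fewG cG ccG.
Qed.

(** By induction on the size of [S], a part in a smaller set embeds in [S]; so the proper subsets
    may be taken monopolar. *)
Lemma mono_or_part (G : sgraph) (S : {set G}) :
  (forall U : {set G}, few_P4 (induced U)) -> mono G S \/ has_part (induced S).
Proof.
move=> fewG; have [n] := ubnP #|S|; elim: n S => // n IHn S Sn.
have [pS|npS] := classic (has_part (induced S)); [by right | left].
have [|/mono_of_induced//|//] := minimal_mono_or_part (fewG S).
move=> U UT; have valU : val @: U \proper S.
  apply/properP; split.
    by apply/subsetP=> _ /imsetP[x _ ->]; apply: valP.
  case/properP: UT => _ [x _ xU]; exists (val x); first exact: valP.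
  by rewrite mem_imset //; apply: val_inj.
have [|mU|pU] := IHn (val @: U).
- by apply: leq_trans (proper_card valU) _; rewrite -ltnS.
- apply: covered_sub (mono_embedding (@embedding_val G S) mU).
  by apply/subsetP=> x xU; rewrite inE imset_f.
- case: npS.
  have sub (x : induced (val @: U)) : val x \in S.
    by apply: (subsetP (proper_sub valU)); apply: valP.
  pose f (x : induced (val @: U)) : induced S := Sub (val x) (sub x).
  apply: (@has_part_embedding _ _ f) pU.
  split=> [x y /(congr1 val)|x y]; last by [].
  by rewrite !SubK => /val_inj.
Qed.

(** * Disconnected minimal obstructions *)

Lemma pol_union (G : sgraph) (X Y : {set G}) :
  {in X & Y, forall x y, ~~ adj x y} -> pol G X -> clu G Y -> pol G (X :|: Y).
Proof.
move=> sep /pol_disjoint[A [AX mA cB]] cY; exists A, ((X :\: A) :|: Y); split=> //.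
  by apply/subsetP=> x /setUP[] xX; rewrite !inE xX ?orbT ?andbT //; case: (x \in A).
have sep' : {in Y & X, forall x y, ~~ adj x y}.
  by move=> x y xY yX; rewrite adj_sym sep.
have BX x : x \in X :\: A -> x \in X by case/setDP.
move=> x y z /setUP[xX|xX] /setUP[yX|yX] /setUP[zX|zX] xy yz;
first [ by apply: (cB x y z) | by apply: (cY x y z)
 | by rewrite (negPf (sep _ _ (BX _ xX) yX)) in xy
 | by rewrite (negPf (sep' _ _ xX (BX _ yX))) in xy
 | by rewrite (negPf (sep _ _ (BX _ yX) zX)) in yz
 | by rewrite (negPf (sep' _ _ yX (BX _ zX))) in yz ].
Qed.

(* If [X] is not monopolar, then a P3 in [Y] completes an obstruction, whereas a
   cluster [Y] would extend a polar partition of [X]. *)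
Lemma separated_minobs (G : sgraph) (X Y : {set G}) :
  (forall U : {set G}, few_P4 (induced U)) -> minimal_polar_obstruction G ->
  {in X & Y, forall x y, ~~ adj x y} -> X :|: Y = [set: G] -> pol G X ->
  mono G X \/ exists2 E, List.In E obstruction_parts &
    iso (compl G) (gjoin (compl (path_graph 3)) E).
Proof.
move=> fewG mG sep XY polX; have [|[E inE [f [fI fA]]]] := mono_or_part X fewG.
  by left.
right; exists E => //; have [x [y [z [xY yY zY xy [yz xDz xz]]]]] :
    exists x y z, [/\ x \in Y, y \in Y, z \in Y, adj x y &
      [/\ adj y z, x != z & ~~ adj x z]].
  have [cY|//] := not_cluP Y; have /minobsP[nG _] := mG.
  by case: nG; rewrite -XY; apply: pol_union.
pose p (i : 'I_3) := nth x [:: x; y; z] i.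
have pY i : p i \in Y by case: i => [[|[|[|]]]].
have pA i j : adj (p i) (p j) = @adj (path_graph 3) i j.
  by case: i j => [[|[|[|]]] // ?] [[|[|[|]]] // ?]; rewrite /p /=; adj_simpl.
have pI : injective p.
  move=> i j /eqP; case: i j => [[|[|[|]]] // ?] [[|[|[|]]] // ?] E';
  apply: val_inj => //=;
  by move: E'; rewrite /p /=; neq_simpl.
(* [X] and [Y] are not assumed disjoint, but each vertex of the P3 has a neighbour in [Y]. *)
have pX i : p i \notin X.
  have [j ij] : exists j, adj (p i) (p j).
    have [i1|i1] := eqVneq i (inord 1); [exists ord0 | exists (inord 1)];
      rewrite pA /= /path_adj ?i1 ?inordK //.
    by case: i i1 => [[|[|[|]]]] // lti; rewrite -val_eqE /= inordK.
  by apply: contraTN ij => iX; apply: sep.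
(* The domain is chosen so that its complement is literally [gjoin (compl (path_graph 3)) E]. *)
pose F (s : dunion (compl (compl (path_graph 3))) (compl E)) : G :=
  match s with inl i => p i | inr e => val (f e) end.
have eF : embedding F.
  split=> [[i|e] [j|e'] /= E'|[i|e] [j|e']].
  - by rewrite (pI _ _ E').
  - by have := pX i; rewrite E' (valP (f e')).
  - by have := pX j; rewrite -E' (valP (f e)).
  - by rewrite (fI _ _ (val_inj E')).
  - exact: etrans (pA i j) (esym (@compl_compl (path_graph 3) i j)).
  - by rewrite /= adj_sym (negPf (sep _ _ (valP (f e')) (pY i))).
  - by rewrite /= (negPf (sep _ _ (valP (f e)) (pY j))).
  - exact: fA.
apply: (embedding_obstruction (embedding_compl eF)); last exact: (minobs_compl G).1.
by have /minobsP[] := minobs_join inE.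
Qed.

Lemma disconnected_minobs (G : sgraph) :
  (forall U : {set G}, few_P4 (induced U)) -> minimal_polar_obstruction G ->
  disconnected G ->
  exists2 E, List.In E obstruction_parts &
    iso (compl G) (gjoin (compl (path_graph 3)) E).
Proof.
move=> fewG mG [X [X0 XT sep]]; have /minobsP[nG polG] := mG.
have polP (V : {set G}) : V != [set: G] -> pol G V.
  rewrite -subTset => /subsetPn[x _ xV]; apply: covered_sub (polG x).
  by apply/subsetP=> y yV; rewrite !inE; apply: contraNneq xV => <-.
have sepX : {in X & ~: X, forall x y, ~~ adj x y}.
  by move=> x y xX; rewrite inE => yX; apply: sep.
have sepX' : {in ~: X & X, forall x y, ~~ adj x y}.
  by move=> x y xX yX; rewrite adj_sym sepX.
have [mX|//] := separated_minobs fewG mG sepX (setUCr X) (polP X XT).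
have [||mY|//] := separated_minobs fewG mG sepX' _ (polP (~: X) _).
- by rewrite setUC setUCr.
- by apply: contra_neq X0 => E; rewrite -[X]setCK E setCT.
by case: nG; apply: mono_pol; rewrite -(setUCr X); apply: mono_union.
Qed.

Theorem theorem55
  (C : sgraph -> Prop)
  (C_iso : forall G H : sgraph, iso G H -> C G -> C H)
  (C_sub : (forall G : sgraph, C G -> P4_extendible G) \/
           (forall G : sgraph, C G -> P4_sparse G))
  (C_compl : forall G : sgraph, C G -> C (compl G))
  (C_induced : forall (G : sgraph) (S : {set G}), C G -> C (induced S))
  (G : sgraph) (hG : C G) :
  minimal_polar_obstruction G <->
  exists E : sgraph,
    List.In E
      [:: dunion (complete 1) (copies (complete 2) 2);
          copies (path_graph 3) 2;
          dunion (copies (complete 1) 2) (cycle_graph 4);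
          dunion (complete 1) (compl (dunion (path_graph 3) (complete 2)));
          dunion (complete 1) (cycle_graph 5);
          dunion (complete 1) banner;
          dunion (complete 1) (compl (path_graph 5))] /\
    (iso G (gjoin (compl (path_graph 3)) E) \/
     iso (compl G) (gjoin (compl (path_graph 3)) E)).
Proof.
have few H : C H -> few_P4 H.
  by case: C_sub => sub CH; [left | right]; apply: sub.
split=> [mG|[E [/minobs_join mE [GE|GE]]]]; last first.
- by apply: (minobs_compl G).2; apply: minobs_iso GE mE.
- exact: minobs_iso GE mE.
have [dG|cG] := classic (disconnected G).
  have [U|E inE isoE] := disconnected_minobs _ mG dG; first exact/few/C_induced.
  by exists E; split=> //; right.
have [dG|ccG] := classic (disconnected (compl G)).
  have mG' : minimal_polar_obstruction (compl G) by apply: (minobs_compl G).1.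
  have [U|E inE [f fb fA]] := disconnected_minobs _ mG' dG.
    exact/few/C_induced/C_compl.
  exists E; split=> //; left; exists f => // x y.
  by rewrite fA compl_compl.
(* Here all proper subsets are polar by minimality, and the first half of [outcome] would make [G]
   polar. *)
have [polG _] := connected_outcome (few G hG) cG ccG.
have /minobsP[nG mG'] := mG; case: nG; apply: polG => U.
rewrite properT -subTset => /subsetPn[x _ xU]; apply: covered_sub (mG' x).
by apply/subsetP=> y yU; rewrite !inE; apply: contraNneq xU => <-.
Qed.
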